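(* Let $U(x)=-e^{-\gamma x}$, $x\in\mathbb R$, with $\gamma>0$, and let $W:S\to(-\infty,0]$ be defined by $V(t,i)=e^{c\gamma t}W(i)$. If $q_i\le c\gamma$, then $W(i)=-e^{-\gamma g(i)}$ and $\tau^*\equiv0$ is optimal (for the initial state $i$). Now suppose that $q_i>c\gamma$. Then: a) It holds that $$W(i)=\max\bigg\{-e^{-\gamma g(i)},\ \sum_{j\ne i}\frac{q_{ij}}{q_i-c\gamma}W(j)\bigg\}.$$ b) There exists a maximizer $f^*:S\to\{0,\infty\}$, where $f^*(i):=0$ if the maximum in a) is attained in the first expression and $f^*(i):=\infty$ if it is attained in the second expression (and $f^*(i):=0$ if $q_i\le c\gamma$). Let $$\tau^*=f^*(Z_0)1_{\{\tau^*<S_1\}}+\sum_{k=1}^\infty\big(f^*(Z_k)+S_k\big)1_{\{S_k\le\tau^*<S_{k+1}\}}\quad\mathbb P\text{-a.s.}$$ and suppose that for $i\in S$, $\mathbb P_i(\tau^*<\infty)=1$ and $$\lim_{n\to\infty}\mathbb E_i\Big[W(Z_n)1_{\{\tau^*\ge S_n\}}\Big]=0 .$$ Then $\tau^*$ is an optimal stopping time for the infinite-horizon stopping problem with exponential utility.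
   Context: Markov chain: on a probability space $(\Omega,\mathcal F,\mathbb P)$, $(X_t)_{t\ge0}$ is a right-continuous continuous-time Markov chain with countable state space $S$ and intensity matrix $Q=(q_{ij})$, $0<q_i:=-q_{ii}=\sum_{j\ne i}q_{ij}<\infty$. Its jump times are $0=S_0<S_1<S_2<\dots$, $Z_n:=X_{S_n}$, and $X_t=\sum_{k\ge0}Z_k1_{\{S_k\le t<S_{k+1}\}}$ for all $t\ge0$; $S_{k+1}-S_k\sim\exp(q_{Z_k})$ and $\mathbb P(Z_{k+1}=j\mid Z_k=i)=q_{ij}/q_i$ for $j\ne i$. $(\mathcal F^X_t)$ is the natural filtration of $X$; $\mathbb P_i,\mathbb E_i$ denote probability and expectation given $X_0=i$. $g:S\to\mathbb R$ is a reward function and $c>0$ a cost rate. $\Sigma$ is the set of $(\mathcal F^X_t)$-stopping times $\tau:\Omega\to[0,\infty)$ with $\mathbb P_i(\tau<\infty)=1$ for all $i\in S$. Standing assumptions: (A1) $\sup_{\tau\in\Sigma}\mathbb E_i[g^+(X_\tau)-c\tau]<\infty$ for all $i\in S$; (A2) $\liminf_{n\to\infty}\mathbb E_i[U(g(X_{\tau\wedge S_n})-c(t+\tau\wedge S_n))]\ge\mathbb E_i[U(g(X_\tau)-c(t+\tau))]$ for all $i\in S$, $t\ge0$, $\tau\in\Sigma$. Markovian stopping times: a Markovian stopping time is identified with a sequence $\tau=(h_0,h_1,\dots)$ of measurable maps $h_k:[0,\infty)\times S\to[0,\infty]$; given elapsed time $t\ge0$ it denotes the random time $\tau=S_k+h_k(t+S_k,Z_k)$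 for the smallest $k\ge0$ with $S_k+h_k(t+S_k,Z_k)<S_{k+1}$ (and $\tau=\infty$ if there is none). The stopping time $\tau^*$ in b) is the one given in this way by $h_k(t,i)=f^*(i)$ for all $k$. $\Sigma^M$ is the class of such sequences for which $\tau$ is $\mathbb P_i$-a.s. finite for all $i\in S$, $t\ge0$. Value function: $V(t,i):=\sup_{\tau\in\Sigma^M}\mathbb E_i\big[U\big(g(X_\tau)-c(t+\tau)\big)\big]$, with $\tau$ formed with elapsed time $t$. For the exponential utility, $V(t,i)=e^{c\gamma t}W(i)$ with $W(i):=V(0,i)$. ''$\tau^*$ optimal'' means that $\tau^*$ attains this supremum. *)

(* Defs.v *)
From HB Require Import structures.
From mathcomp Require Import all_boot all_order all_algebra.
From mathcomp Require Import all_classical all_reals all_analysis.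
From mathcomp Require Import measurable_realfun.
Import Order.TTheory GRing.Theory Num.Theory.
Import numFieldNormedType.Exports.

Set Implicit Arguments.
Unset Strict Implicit.
Unset Printing Implicit Defensive.

Local Open Scope classical_set_scope.
Local Open Scope ring_scope.

(* Throughout, [P i] is the law given [X_0 = i], [X] the chain, [T n] the n-th
   jump time S_n (so [S] can be the state space) and [q] the intensity matrix.
   Random times take values in [0, +oo] and are typed in \bar R. *)

Definition rate (R : realType) (S : Type) (q : S -> S -> R) (i : S) : R :=
  - q i i.

Definition jump_state (R : realType) (S Omega : Type)
    (X : R -> Omega -> S) (T : nat -> Omega -> R) (n : nat) (w : Omega) : S :=
  X (T n w) w.

Definition jump_history (R : realType) (S Omega : Type)
    (X : R -> Omega -> S) (T : nat -> Omega -> R) (k : nat) : set (set Omega) :=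
  <<s [set A | exists2 m, (m <= k)%N &
        (exists i, A = [set w | jump_state X T m w = i]) \/
        (exists2 B, measurable B & A = T m @^-1` B)] >>.

(* [chain_law] says that, given (T 0, Z 0, ..., T k, Z k) with Z k = a, the
   holding time T (k+1) - T k is exp(rate a)-distributed, the next state is b
   with probability q a b / rate a, and the two are independent.  Right
   continuity of the paths is contained in [chain_path]. *)
Record markov_chain (R : realType) (S : countType) (d : measure_display)
    (Omega : measurableType d) (P : S -> probability Omega R)
    (q : S -> S -> R) (X : R -> Omega -> S) (T : nat -> Omega -> R) : Prop :=
  MarkovChain {
  intensity_ge0 : forall i j, j != i -> 0 <= q i j ;
  rate_gt0 : forall i, 0 < rate q i ;
  intensity_row_sum : forall i,
    (\esum_(j in [set~ i]) (q i j)%:E = (rate q i)%:E)%E ;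
  chain_measurable : forall (t : R) i, 0 <= t -> measurable [set w | X t w = i] ;
  jump_time_measurable : forall n, measurable_fun [set: Omega] (T n) ;
  jump_state_measurable : forall n i,
    measurable [set w | jump_state X T n w = i] ;
  jump_time0 : forall w, T 0%N w = 0 ;
  jump_time_lt : forall n w, T n w < T n.+1 w ;
  jump_time_cover : forall w (t : R), 0 <= t -> exists k, T k w <= t < T k.+1 w ;
  chain_path : forall k w t,
    T k w <= t < T k.+1 w -> X t w = jump_state X T k w ;
  jump_neq : forall k w, jump_state X T k.+1 w <> jump_state X T k w ;
  chain_start : forall i, P i [set w | X 0 w = i] = 1%E ;
  chain_law : forall (i : S) (k : nat) (A : set Omega) (a b : S) (B : set R),
    jump_history X T k A -> b != a -> measurable B ->
    (P i (A `&` [set w | [/\ jump_state X T k w = a, jump_state X T k.+1 w = b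
                           & B (T k.+1 w - T k w)%R]]) =
     P i (A `&` [set w | jump_state X T k w = a]) *
       exponential_prob (rate q a) B * (q a b / rate q a)%R%:E)%E }.

Definition natural_filtration (R : realType) (S Omega : Type)
    (X : R -> Omega -> S) (t : R) : set (set Omega) :=
  <<s [set A | exists s i, 0 <= s <= t /\ A = [set w | X s w = i]] >>.

(* An a.s. finite stopping time may be +oo on a null set. *)
Definition stopping_times (R : realType) (S : countType) (d : measure_display)
    (Omega : measurableType d) (P : S -> probability Omega R)
    (X : R -> Omega -> S) : set (Omega -> \bar R) :=
  [set tau | [/\ forall w, (0 <= tau w)%E,
    forall t, 0 <= t -> natural_filtration X t [set w | (tau w <= t%:E)%E]
    & forall i, P i [set w | (tau w < +oo)%E] = 1%E]].

(* [fine] sends +oo to 0; this only concerns the null event {tau = +oo}. *)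
Definition gain (R : realType) (S Omega : Type) (U : R -> R) (g : S -> R)
    (c : R) (X : R -> Omega -> S) (t : R) (tau : Omega -> \bar R) (w : Omega)
    : R :=
  U (g (X (fine (tau w)) w) - c * (t + fine (tau w))).

Definition assumption_A1 (R : realType) (S : countType) (d : measure_display)
    (Omega : measurableType d) (P : S -> probability Omega R)
    (X : R -> Omega -> S) (g : S -> R) (c : R) : Prop :=
  forall i : S,
    (ereal_sup [set 'E_(P i)[fun w =>
                       (Num.max (g (X (fine (tau w)) w)) 0
                        - c * fine (tau w))%R]
                | tau in stopping_times P X] < +oo)%E.

Definition assumption_A2 (R : realType) (S : countType) (d : measure_display)
    (Omega : measurableType d) (P : S -> probability Omega R)
    (X : R -> Omega -> S) (T : nat -> Omega -> R) (U : R -> R) (g : S -> R)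
    (c : R) : Prop :=
  forall (i : S) (t : R) (tau : Omega -> \bar R),
    0 <= t -> stopping_times P X tau ->
    ('E_(P i)[gain U g c X t tau] <=
     limn_einf (fun n =>
       'E_(P i)[gain U g c X t (fun w => mine (tau w) (T n w)%:E)]))%E.

(* S carries the discrete sigma-algebra, so joint measurability of a map on
   [0, +oo[ x S is measurability of its sections. *)
Definition decision_rules (R : realType) (S : Type)
    : set (nat -> R -> S -> \bar R) :=
  [set h : nat -> R -> S -> \bar R | forall k i,
     measurable_fun (`[0, +oo[ : set R) (fun t : R => h k t i) /\
     forall t : R, 0 <= t -> (0 <= h k t i)%E].

Definition stops_at (R : realType) (S Omega : Type) (X : R -> Omega -> S)
    (T : nat -> Omega -> R) (h : nat -> R -> S -> \bar R) (t : R) (w : Omega)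
    (k : nat) : bool :=
  ((T k w)%:E + h k (t + T k w)%R (jump_state X T k w) < (T k.+1 w)%:E)%E.

Definition markovian_time (R : realType) (S Omega : Type) (X : R -> Omega -> S)
    (T : nat -> Omega -> R) (h : nat -> R -> S -> \bar R) (t : R) (w : Omega)
    : \bar R :=
  match pselect (exists k, stops_at X T h t w k) with
  | left stops => let k := ex_minn stops in
      ((T k w)%:E + h k (t + T k w)%R (jump_state X T k w))%E
  | right _ => +oo%E
  end.

Definition markovian_times (R : realType) (S : countType) (d : measure_display)
    (Omega : measurableType d) (P : S -> probability Omega R)
    (X : R -> Omega -> S) (T : nat -> Omega -> R)
    : set (nat -> R -> S -> \bar R) :=
  [set h : nat -> R -> S -> \bar R | decision_rules h /\
    forall i t, 0 <= t -> P i [set w | (markovian_time X T h t w < +oo)%E] = 1%E].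

Definition expected_gain (R : realType) (S : countType) (d : measure_display)
    (Omega : measurableType d) (P : S -> probability Omega R)
    (X : R -> Omega -> S) (T : nat -> Omega -> R) (U : R -> R) (g : S -> R)
    (c : R) (h : nat -> R -> S -> \bar R) (t : R) (i : S) : \bar R :=
  'E_(P i)[gain U g c X t (markovian_time X T h t)].

Definition value (R : realType) (S : countType) (d : measure_display)
    (Omega : measurableType d) (P : S -> probability Omega R)
    (X : R -> Omega -> S) (T : nat -> Omega -> R) (U : R -> R) (g : S -> R)
    (c t : R) (i : S) : \bar R :=
  ereal_sup [set expected_gain P X T U g c h t i | h in markovian_times P X T].

Definition exp_utility (R : realType) (gamma x : R) : R := - expR (- gamma * x).

(* [\esum] is meant for nonnegative terms only. *)
Definition signed_sum (R : realType) (S : choiceType) (D : set S)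
    (f : S -> \bar R) : \bar R :=
  (\esum_(j in D) f^\+ j - \esum_(j in D) f^\- j)%E.

Definition stop_value (R : realType) (S : Type) (gamma : R) (g : S -> R)
    (i : S) : R := - expR (- gamma * g i).

Definition continuation_value (R : realType) (S : choiceType) (q : S -> S -> R)
    (c gamma : R) (W : S -> R) (i : S) : \bar R :=
  signed_sum [set~ i] (fun j => (q i j / (rate q i - c * gamma) * W j)%:E).

(* Where both expressions attain the maximum, either choice is allowed. *)
Definition maximizer (R : realType) (S : choiceType) (q : S -> S -> R)
    (c gamma : R) (g W : S -> R) (f : S -> \bar R) : Prop :=
  forall i,
    let stop := (stop_value gamma g i)%:E in
    let continue := continuation_value q c gamma W i in
    (rate q i <= c * gamma -> f i = 0%E) /\
    (c * gamma < rate q i ->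
       (f i = 0%E /\ maxe stop continue = stop) \/
       (f i = +oo%E /\ maxe stop continue = continue)).

(* Main.v *)
From HB Require Import structures.
Require Import Defs.
From mathcomp Require Import all_boot all_order all_algebra.
From mathcomp Require Import all_classical all_reals all_analysis.
From mathcomp Require Import measurable_realfun.
From mathcomp Require Import ring.
Import Order.TTheory GRing.Theory Num.Theory.
Import numFieldNormedType.Exports.

Set Implicit Arguments.
Unset Strict Implicit.
Unset Printing Implicit Defensive.

Local Open Scope classical_set_scope.
Local Open Scope ring_scope.

(** Write a = c gamma, G(i) = exp (- gamma g(i)) and v = - W: the problem is to
    minimise the expected cost E_i [exp (a tau) G(X_tau)].

    The problem in which one has to stop at the n-th jump at the latest is
    solved by value iteration: v_0 = G and v_(n+1) = bellman v_n, where
    bellman u i is G(i) if q_i <= a and otherwise the minimum of G(i) and of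
    K = sum_j q_ij u(j) / (q_i - a).  The reason is a computation at a single
    jump ([bellman_le_one_jump]).  Who decides in state i to stop after a delay
    h, and has to pay u at the next jump if that comes first, pays on average
    G(i) s + K (1 - s) with s = exp (- (q_i - a) h), which is a convex
    combination of stopping at once and of waiting for the jump: only the
    delays 0 and infinity matter.  If q_i <= a the cost grows at least as fast
    as the tail of the holding time decays, and waiting never pays.  Thus a
    rule truncated at the n-th jump costs at least v_n
    ([payoff_ge_value_iter]), and a rule that uses only the delays 0 and
    infinity attains v_n ([horizon_cost_le]).

    Assumption (A2) carries the lower bound from the truncated rules to the
    rules themselves: every rule that is finite almost surely costs at least
    v_oo = inf_n v_n ([value_inf_le_cost]).  As (A2) speaks of stopping times
    of the natural filtration, this needs that the rules define such times
    ([rule_time_stopping]).  Hence W = - v_oo ([valueE]).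

    Assertion a) says that v_oo is a fixed point of bellman
    ([value_inf_fixpoint]).  This is not a passage to the limit in the sums,
    since sum_j q_ij v_n(j) may be infinite for all n although
    sum_j q_ij v_oo(j) is finite.  The inequality v_oo <= K comes from the
    lower bound, applied to the following rule: wait for the first jump and,
    if it leads to j, go on with an N(j)-jump rule that is almost optimal from
    j.  All later decisions of this rule depend on the first state reached by a
    jump, so that it is not Markovian; this is why everything is proved for rules
    that may use the whole history of the jumps ([adapted_rule]).

    For b), iterating the fixed point equation along tau* shows that the cost
    collected during the first n jumps is at most v_oo ([payoff_le]), and
    monotone convergence bounds the cost of tau* by v_oo
    ([maximizer_cost_le]).  The other inequality is the lower bound. *)

(** * Measures, integrals and sums *)

(** The measure structure of [exponential_prob r] depends on a proof that r is
    positive; an abstract probability with the same values is easier to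
    integrate against. *)
Lemma exponential_probability (R : realType) (r : R) : 0 < r ->
  exists nu : probability (measurableTypeR R) R,
    forall B, nu B = exponential_prob r B.
Proof.
move=> r0.
unshelve eexists (exponential_prob r : probability (measurableTypeR R) R); last by [].
exact: r0.
Qed.

Lemma integral_mrestr d (T : measurableType d) (R : realType)
  (mu : {measure set T -> \bar R}) (D : set T) (mD : measurable D) (f : T -> \bar R) :
  measurable_fun setT f -> (forall x, 0 <= f x)%E ->
  (\int[mrestr mu mD]_x f x = \int[mu]_(x in D) f x)%E.
Proof.
move=> mf f0; have mDC := measurableC mD.
rewrite -(setUv D) ge0_integral_setU//; last 2 first.
- by rewrite setUv.
- exact/disj_setPCl.
rewrite [X in (_ + X)%E](eq_measure_integral (mzero : {measure set T -> \bar R})); last first.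
  move=> A mA AD; rewrite /= /mrestr.
  by rewrite (_ : A `&` D = set0) ?measure0// -subset0 => x [/AD].
rewrite integral_measure_zero adde0.
by apply: eq_measure_integral => A mA AD; rewrite /= /mrestr setIidl.
Qed.

Import HBNNSimple.

(** The identity holds for indicator functions by hypothesis, hence for simple
    functions by linearity and in general by monotone convergence. *)
Lemma integral_density d (T : measurableType d) (R : realType)
  (mu nu : {measure set T -> \bar R}) (h : T -> R) :
  measurable_fun setT h -> (forall x, 0 <= h x) ->
  (forall A, measurable A -> nu A = \int[mu]_(x in A) (h x)%:E)%E ->
  forall f : T -> \bar R, measurable_fun setT f -> (forall x, 0 <= f x)%E ->
  (\int[nu]_x f x = \int[mu]_x (f x * (h x)%:E))%E.
Proof.
move=> mh h0 nuE f mf f0; pose f_ := nnsfun_approx measurableT mf.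
have mhE : measurable_fun setT (EFin \o h) by apply/measurable_EFinP.
have step (u : {nnsfun T >-> R}) :
    (\int[nu]_x (u x)%:E = \int[mu]_x ((u x)%:E * (h x)%:E))%E.
  under [LHS]eq_integral do rewrite fimfunE -fsumEFin//.
  rewrite [LHS]ge0_integral_fsum//; last 2 first.
    - by move=> r; exact/measurable_EFinP/measurableT_comp.
    - by move=> n x _; rewrite EFinM nnfun_muleindic_ge0.
  under [RHS]eq_integral.
    move=> x xD; rewrite fimfunE -fsumEFin// ge0_mule_fsuml; last first.
      by move=> r; rewrite EFinM nnfun_muleindic_ge0.
    over.
  rewrite [RHS]ge0_integral_fsum//; last 2 first.
    - move=> r; apply: emeasurable_funM => //.
      by apply/measurable_EFinP/measurableT_comp.
    - move=> n x _; apply: mule_ge0; last by rewrite lee_fin.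
      by rewrite EFinM nnfun_muleindic_ge0.
  apply: eq_fsbigr => r _.
  have [r0|r0] := ltP r 0.
    rewrite preimage_nnfun0//.
    by rewrite !integral0_eq// => x _; rewrite indic0/= mulr0 ?mul0e.
  under eq_integral do rewrite EFinM.
  under [RHS]eq_integral do rewrite EFinM -muleA.
  have mi : measurable_fun setT (fun x => (\1_(u @^-1` [set r]) x)%:E : \bar R).
    by apply/measurable_EFinP.
  rewrite ge0_integralZl//.
  rewrite [RHS]ge0_integralZl//; last 2 first.
  - exact: emeasurable_funM.
  - by move=> x _; rewrite mule_ge0// lee_fin.
  congr (_ * _)%E; rewrite integral_indic// setIT nuE// integral_mkcond.
  apply: eq_integral => x _; rewrite patchE indicE.
  by case: ifPn => _; rewrite ?mul1e ?mul0e.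
transitivity (limn (fun n => \int[nu]_x (f_ n x)%:E))%E.
  rewrite -monotone_convergence//=.
  - apply: eq_integral => x _; apply/esym/cvg_lim => //=.
    by apply: cvg_nnsfun_approx => // *.
  - by move=> n; apply: measurableT_comp => //; exact: measurable_funTS.
  - by move=> n x _; rewrite lee_fin.
  - by move=> x _ a b ab; rewrite lee_fin//; exact/lefP/nd_nnsfun_approx.
under eq_fun do rewrite step.
rewrite -monotone_convergence//=.
- apply: eq_integral => x _.
  apply/cvg_lim => //=; apply: cvgeZr => //.
  by apply: cvg_nnsfun_approx => // *.
- move=> n; apply: emeasurable_funM => //.
  by apply: measurableT_comp => //; exact: measurable_funTS.
- by move=> n x _; rewrite mule_ge0 ?lee_fin.
- move=> x _ a b ab; rewrite lee_pmul ?lee_fin//.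
  exact/lefP/nd_nnsfun_approx.
Qed.

(** If, up to the factor p, y is independent of phi with law nu, then the joint
    law of phi and y is a product measure, because the two agree on rectangles;
    the claim is then the theorem of Tonelli.  Two different events D and D'
    are allowed because, for a jump, D' also prescribes the next state, and p
    is the probability of the latter given the history. *)
Lemma integral_product_law d1 d2 d3 (Om : measurableType d1) (E : measurableType d2)
    (Y : measurableType d3) (R : realType) (P : probability Om R)
    (nu : probability Y R) (phi : Om -> E) (y : Om -> Y) (p : R) (D D' : set Om) :
  measurable_fun setT phi -> measurable_fun setT y -> 0 <= p ->
  measurable D -> measurable D' ->
  (forall A B, measurable A -> measurable B ->
    P (D' `&` (phi @^-1` A `&` y @^-1` B)) = p%:E * P (D `&` phi @^-1` A) * nu B)%E ->
  forall F : E * Y -> \bar R, measurable_fun setT F -> (forall z, 0 <= F z)%E ->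
  (\int[P]_(w in D') F (phi w, y w) =
   p%:E * \int[P]_(w in D) \int[nu]_t F (phi w, t))%E.
Proof.
move=> mphi my p0 mD mD' H F mF F0.
have mphiy : measurable_fun setT (fun w => (phi w, y w)).
  exact/measurable_fun_pairP.
have [m' m'E] : exists m' : {measure set (E * Y) -> \bar R},
    m' = pushforward (mrestr P mD') (fun w => (phi w, y w)) :> (set _ -> _).
  by unshelve eexists (pushforward (mrestr P mD') (fun w => (phi w, y w))
    : {measure set (E * Y) -> \bar R}).
have [m0 m0E] : exists m0 : {measure set E -> \bar R},
    m0 = pushforward (mrestr P mD) phi :> (set _ -> _).
  by unshelve eexists (pushforward (mrestr P mD) phi : {measure set E -> \bar R}).
have [m1 m1E] : exists m1 : {finite_measure set E -> \bar R},
    m1 = mscale (NngNum p0) m0 :> (set _ -> _).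
  pose fm : {measure set E -> \bar R} := mscale (NngNum p0) m0.
  have fin : fin_num_fun fm.
    move=> A mA; rewrite /fm /= /mscale /= fin_numM// m0E /pushforward /mrestr.
    apply: fin_num_measure; apply: measurableI => //.
    by rewrite -[X in measurable X]setTI; exact: mphi.
  pose H1 := Measure_isFinite.Build _ _ _ fm fin.
  by exists (HB.pack_for {finite_measure set E -> \bar R} (Measure.sort fm) H1).
transitivity (\int[m']_z F z)%E.
  rewrite m'E ge0_integral_pushforward//.
  rewrite preimage_setT integral_mrestr//; first exact: measurableT_comp.
  by move=> w; exact: F0.
transitivity (\int[m1 \x nu]_z F z)%E.
  apply: eq_measure_integral => A mA _; apply/esym.
  apply: product_measure_unique => // A1 A2 mA1 mA2.
  rewrite [LHS](congr1 (fun f => f _) m'E).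
  rewrite [X in (X * _)%E](congr1 (fun f => f _) m1E).
  rewrite /mscale/= m0E /pushforward /mrestr /=.
  by rewrite setIC [phi @^-1` A1 `&` D]setIC; exact: H.
rewrite fubini_tonelli1//.
transitivity (\int[mscale (NngNum p0) m0]_x fubini_F nu F x)%E.
  apply: eq_measure_integral => A _ _; exact: (congr1 (fun f => f A) m1E).
rewrite ge0_integral_mscale//=; last 2 first.
- exact: measurable_fun_fubini_tonelli_F.
- by move=> x _; apply: integral_ge0.
congr (_ * _)%E; rewrite m0E ge0_integral_pushforward//; last 2 first.
- exact: measurable_fun_fubini_tonelli_F.
- by move=> x _; apply: integral_ge0.
rewrite preimage_setT integral_mrestr//.
- by apply: measurableT_comp => //; exact: measurable_fun_fubini_tonelli_F.
- by move=> x; apply: integral_ge0.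
Qed.

(** An infinite factor k occurs: it will be an expected discount factor, which
    need not be finite. *)
Lemma ge0_esumZl (R : realType) (I : choiceType) (D : set I) (k : \bar R)
    (a : I -> \bar R) : (0 <= k)%E -> (forall i, D i -> 0 <= a i)%E ->
  (\esum_(i in D) (k * a i) = k * \esum_(i in D) a i)%E.
Proof.
wlog a0 : a / (forall i, 0 <= a i)%E.
  move=> H k0 a0; pose b i := if i \in D then a i else 0%E.
  rewrite (@eq_esum _ _ D a b); last by move=> i Di; rewrite /b mem_set.
  rewrite (@eq_esum _ _ D _ (fun i => k * b i)%E); last first.
    by move=> i Di; rewrite /b mem_set.
  have b0 i : (0 <= b i)%E by rewrite /b; case: ifPn => // /[!inE]; exact: a0.
  by apply: H.
case: k => [k| |]// k0 _.
  rewrite /esum -ereal_supZl ?lee_fin//; last first.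
    by apply/set0P; eexists; exists set0; [exact: fsets_set0|reflexivity].
  congr ereal_sup; apply/seteqP; split => x /=.
    move=> [A fA <-]; exists (\sum_(i \in A) a i)%E; first by exists A.
    by rewrite ge0_mule_fsumr.
  by move=> [_ [A fA <-] <-]; exists A; rewrite // ge0_mule_fsumr.
have [/eqP S0|S0] := eqVneq (\esum_(i in D) a i)%E 0%E.
  rewrite (eqP S0) mule0; apply: esum1 => i Di.
  suff -> : a i = 0%E by rewrite mule0.
  apply/eqP; rewrite eq_le a0 andbT -(eqP S0).
  apply: esum_ge; exists [set i]; first by split; [exact: finite_set1|move=> _ ->].
  by rewrite fsbig_set1.
have Sp : (0 < \esum_(i in D) a i)%E by rewrite lt0e S0 esum_ge0.
rewrite gt0_mulye//; apply/eqP; rewrite -leye_eq.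
have [i Di ai] : exists2 i, D i & (0 < a i)%E.
  apply: contrapT => H; move: S0; rewrite esum1 ?eqxx// => i Di.
  apply/eqP; rewrite eq_le a0 andbT leNgt; apply/negP => ai.
  by apply: H; exists i.
apply: esum_ge; exists [set i]; first by split; [exact: finite_set1|move=> _ ->].
by rewrite fsbig_set1 gt0_mulye.
Qed.

(** The states are numbered by [pickle], which turns the sum over the countable
    type into a series. *)
Lemma ge0_integral_fibers d (Om : measurableType d) (R : realType)
    (mu : {measure set Om -> \bar R}) (S : countType) (Z : Om -> S) (D : set Om)
    (f : Om -> \bar R) :
  (forall i, measurable [set w | Z w = i]) -> measurable D ->
  measurable_fun D f -> (forall w, D w -> 0 <= f w)%E ->
  (\int[mu]_(w in D) f w =
   \esum_(i in setT) \int[mu]_(w in D `&` [set w | Z w = i]) f w)%E.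
Proof.
move=> mZ mD mf f0.
pose F n := D `&` [set w | pickle (Z w) = n].
have mF n : measurable (F n).
  apply: measurableI => //.
  have [[i Hi]|H] := pselect (exists i : S, pickle i = n).
    rewrite (_ : [set _ | _] = [set w | Z w = i])//.
    apply/seteqP; split => w /=; last by move=> ->.
    by rewrite -Hi => /(pcan_inj pickleK).
  rewrite (_ : [set _ | _] = set0)//; apply/seteqP; split => w //= Hw.
  by apply: H; exists (Z w).
have DF : D = \bigcup_n F n.
  apply/seteqP; split => [w Dw|w [n _ []]//]; by exists (pickle (Z w)).
rewrite {1}DF ge0_integral_bigcup -?DF//; last first.
  apply/trivIsetP => m n _ _ mn; rewrite -subset0 => w [[_ /= wm] [_ /= wn]].
  by move: mn; rewrite -wm wn eqxx.
rewrite nneseries_esumT; last first.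
  by move=> n; apply: integral_ge0 => w [? _]; exact: f0.
rewrite (esumID (pickle @` [set: S])); last first.
  by move=> n _; apply: integral_ge0 => w [? _]; exact: f0.
rewrite [X in (_ + X)%E]esum1 ?adde0; last first.
  move=> n [_ /= H]; rewrite (_ : F n = set0) ?integral_set0//.
  by rewrite -subset0 => w [_ /= Hw]; apply: H; exists (Z w).
rewrite setTI esum_image; last by move=> i j _ _ /(pcan_inj pickleK).
apply: eq_esum => i _; congr integral; congr (_ `&` _).
by apply/seteqP; split => w /= => [/(pcan_inj pickleK)|->].
Qed.

Lemma measurable_fun_fibers d d' (Om : measurableType d) (E : measurableType d')
    (S : countType) (Z : Om -> S) (u : S -> E) :
  (forall i, measurable [set w | Z w = i]) -> measurable_fun setT (u \o Z).
Proof.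
move=> mZ _ B mB; rewrite setTI.
rewrite (_ : _ @^-1` B = \bigcup_i (if u i \in B then [set w | Z w = i] else set0)).
  apply: countable_bigcupT_measurable => // i.
  by case: ifPn.
apply/seteqP; split => w /=; first by move=> Bw; exists (Z w); rewrite // mem_set.
by move=> [i _]; case: ifPn => // /[!inE] uB /= ->.
Qed.

Lemma esum_mul_gt0 (R : realType) (I : choiceType) (D : set I) (p u : I -> \bar R) :
  (forall i, D i -> 0 <= p i)%E -> (forall i, 0 < u i)%E ->
  (0 < \esum_(i in D) p i -> 0 < \esum_(i in D) (p i * u i))%E.
Proof.
move=> p0 u0; apply: contraTT => pu.
have pu0 i : D i -> (0 <= p i * u i)%E by move=> Di; rewrite mule_ge0 ?p0 ?(ltW (u0 i)).
have puE : (\esum_(i in D) (p i * u i) = 0)%E.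
  by apply/eqP; rewrite eq_le esum_ge0// andbT leNgt.
rewrite esum1 ?ltxx// => i Di; apply/eqP; rewrite eq_le p0// andbT.
have : (p i * u i <= 0)%E.
  rewrite -puE; apply: esum_ge; exists [set i].
    by split; [exact: finite_set1|move=> _ ->].
  by rewrite fsbig_set1.
by rewrite pmule_lle0.
Qed.

(** * The exponential law *)

(** The exponential tail, for a threshold that may be infinite. *)
Definition survival (R : realType) (r : R) (H : \bar R) : R :=
  if H is h%:E then expR (- r * h) else 0.

Lemma measurable_le_cst (R : realType) (H : \bar R) :
  measurable [set y : measurableTypeR R | (y%:E <= H)%E].
Proof.
have mE : measurable_fun setT (EFin : measurableTypeR R -> \bar R) by [].
rewrite (_ : [set _ | _] = setT `&` EFin @^-1` [set` Interval -oo%O (BRight H)]).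
  exact: mE measurableT _ (emeasurable_itv _).
by apply/seteqP; split => y; rewrite /= in_itv/= => // -[].
Qed.

Lemma exponential_cdf (R : realType) (r : R) (H : \bar R) : 0 < r -> (0 <= H)%E ->
  exponential_prob r [set y | (y%:E <= H)%E] = (1 - survival r H)%:E.
Proof.
move=> r0; case: H => [h| |]//; last first.
  move=> _; rewrite (_ : [set _ | _] = setT); last first.
    by apply/seteqP; split => // y _ /=; rewrite leey.
  by rewrite /exponential_prob integral_exponential_pdf// subr0.
rewrite lee_fin => h0.
rewrite (_ : exponential_prob r _ = exponential_prob r `[0, h]); last first.
  rewrite /exponential_prob integral_mkcond [RHS]integral_mkcond.
  apply: eq_integral => y _; rewrite !patchE.
  have [y0|y0] := ltP y 0; first by rewrite lt0_exponential_pdf// !if_same.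
  rewrite (_ : (y \in _) = (y \in `[0, h]%classic))//.
  by apply/idP/idP; rewrite !inE/= in_itv/= y0 lee_fin.
move: h0; rewrite le_eqVlt => /orP[/eqP <-|h0].
  by rewrite /exponential_prob set_itv1 integral_set1/= mulr0 expR0 subrr.
by rewrite exponential_prob_itv0c// /survival EFinB.
Qed.

Lemma exponential_survival (R : realType) (r : R) (H : \bar R) : 0 < r -> (0 <= H)%E ->
  exponential_prob r [set y | (H < y%:E)%E] = (survival r H)%:E.
Proof.
move=> r0 H0; have [nu nuE] := exponential_probability r0.
rewrite (_ : [set _ | _] = ~` [set y | (y%:E <= H)%E]); last first.
  by apply/seteqP; split => y /=; rewrite ltNge => /negP.
rewrite -nuE probability_setC; last exact: measurable_le_cst.
by rewrite nuE exponential_cdf// -EFinB opprB addrC subrK.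
Qed.

(** Multiplied by exp (a y), the density of rate r becomes r / (r - a) times
    the density of rate r - a. *)
Lemma exponential_discount (R : realType) (nu : probability (measurableTypeR R) R)
    (r a : R) (H : \bar R) :
  (forall B, nu B = exponential_prob r B) -> 0 < r -> a < r -> (0 <= H)%E ->
  (\int[nu]_(y in [set y | (y%:E <= H)%E]) (expR (a * y))%:E =
   (r / (r - a) * (1 - survival (r - a) H))%:E)%E.
Proof.
move=> nuE r0 ar H0; have ra0 : 0 < r - a by rewrite subr_gt0.
have mD := measurable_le_cst H.
have me : measurable_fun setT (fun y : R => (expR (a * y))%:E).
  by apply/measurable_EFinP; apply: measurableT_comp => //; exact: mulrl_measurable.
rewrite integral_mkcond.
rewrite (@integral_density _ (measurableTypeR R) _ lebesgue_measure _ (exponential_pdf r)); last first.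
- by move=> y; apply: erestrict_ge0 => x _; rewrite lee_fin expR_ge0.
- by apply/(measurable_restrictT _ mD)/measurable_funTS.
- by move=> A mA; exact: nuE.
- by move=> y; rewrite exponential_pdf_ge0// ltW.
- exact: measurable_exponential_pdf.
rewrite EFinM -(exponential_cdf ra0 H0) /exponential_prob -ge0_integralZl//; last 3 first.
- by apply/measurable_EFinP/measurable_funTS; exact: measurable_exponential_pdf.
- by move=> y _; rewrite lee_fin exponential_pdf_ge0// ltW.
- by rewrite lee_fin divr_ge0// ltW.
rewrite [RHS]integral_mkcond; apply: eq_integral => y _; rewrite !patchE.
case: ifPn => _; last by rewrite mul0e.
have [y0|y0] := ltP y 0; first by rewrite !lt0_exponential_pdf// !mule0.
rewrite !exponential_pdfE// -!EFinM; congr EFin.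
rewrite mulrCA mulrA [r / _ * _]mulrA divfK ?gt_eqF//.
by rewrite -mulrA -expRD; congr (_ * expR _); ring.
Qed.

(** For r <= a the integrand times the density is at least r on [0, +oo[. *)
Lemma exponential_discount_infty (R : realType) (nu : probability (measurableTypeR R) R)
    (r a : R) :
  (forall B, nu B = exponential_prob r B) -> 0 < r -> r <= a ->
  (\int[nu]_y (expR (a * y))%:E = +oo)%E.
Proof.
move=> nuE r0 ra.
have me : measurable_fun setT (fun y : R => (expR (a * y))%:E).
  by apply/measurable_EFinP; apply: measurableT_comp => //; exact: mulrl_measurable.
have mp : measurable_fun setT (fun y : R => (exponential_pdf r y)%:E).
  by apply/measurable_EFinP; exact: measurable_exponential_pdf.
rewrite (@integral_density _ (measurableTypeR R) _ lebesgue_measure _ (exponential_pdf r)); last first.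
- by move=> y; rewrite lee_fin expR_ge0.
- by [].
- by move=> A mA; exact: nuE.
- by move=> y; rewrite exponential_pdf_ge0// ltW.
- exact: measurable_exponential_pdf.
apply/eqP; rewrite -leye_eq.
have <- : (\int[lebesgue_measure]_(y in `[0%R, +oo[) (cst r%:E y) = +oo :> \bar R)%E.
  rewrite integral_cst//= lebesgue_measure_itv/= ltry.
  by rewrite oppr0 addye// gt0_muley// lte_fin.
rewrite [leLHS]integral_mkcond; apply: ge0_le_integral => //.
- by move=> y _; apply: erestrict_ge0 => x _; rewrite lee_fin ltW.
- apply: (measurable_restrictT _ _).1 => //.
- by apply: emeasurable_funM.
move=> y _; rewrite patchE; case: ifPn => [|_]; last first.
  by rewrite mule_ge0// lee_fin ?expR_ge0// exponential_pdf_ge0// ltW.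
rewrite inE/= in_itv/= andbT => y0; rewrite exponential_pdfE// -EFinM lee_fin.
rewrite mulrCA -expRD.
rewrite ler_peMr ?(ltW r0)//.
rewrite -[X in X <= _]expR0 ler_expR mulNr -mulrBl mulr_ge0// subr_ge0//.
Qed.

Section optimal_stopping.
Context (R : realType) (S : countType) (d : measure_display)
  (Omega : measurableType d) (P : S -> probability Omega R) (q : S -> S -> R)
  (X : R -> Omega -> S) (T : nat -> Omega -> R)
  (XT_chain : markov_chain P q X T).
Local Notation Z := (jump_state X T).
Context (alpha : R) (G : S -> R) (G0 : forall a, 0 < G a).

(** * One jump of the chain *)

(** Naming the generators of [jump_history] makes it the sigma-algebra of a
    measurable type with carrier Omega, so that the measurability of functions
    of the history can be expressed and Tonelli applied to it. *)
Definition history_generators k : set (set Omega) := [set A | exists2 m, (m <= k)%N &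
        (exists i, A = [set w | Z m w = i]) \/
        (exists2 B, measurable B & A = T m @^-1` B)].

Definition history k := g_sigma_algebraType (history_generators k).

Lemma jump_historyE k (A : set Omega) :
  jump_history X T k A = measurable (A : set (history k)).
Proof. by []. Qed.

Lemma history_le k l (A : set Omega) : (k <= l)%N ->
  measurable (A : set (history k)) -> measurable (A : set (history l)).
Proof.
move=> kl; apply: sub_sigma_algebra2 => B [m mk HB]; exists m => //.
exact: leq_trans mk kl.
Qed.

Lemma history_measurable k (A : set Omega) :
  measurable (A : set (history k)) -> measurable A.
Proof.
apply: smallest_sub; first exact: sigma_algebra_measurable.
move=> B [m _ [[i ->]|[C mC ->]]]; first exact: (jump_state_measurable XT_chain).
by rewrite -[X in measurable X]setTI; exact: (jump_time_measurable XT_chain).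
Qed.

Lemma history_fun_measurable k d' (E : measurableType d') (f : Omega -> E) :
  measurable_fun setT (f : history k -> E) -> measurable_fun setT f.
Proof. by move=> mf _ B mB; apply: (@history_measurable k); exact: mf. Qed.

Lemma history_fun_le k l d' (E : measurableType d') (f : Omega -> E) : (k <= l)%N ->
  measurable_fun setT (f : history k -> E) ->
  measurable_fun setT (f : history l -> E).
Proof. by move=> kl mf _ B mB; apply: (@history_le k) => //; exact: mf. Qed.

Lemma history_time k m : (m <= k)%N -> measurable_fun setT (T m : history k -> R).
Proof.
move=> mk _ B mB; rewrite setTI; apply: sub_sigma_algebra.
by exists m => //; right; exists B.
Qed.

Lemma history_state k m i : (m <= k)%N -> measurable ([set w | Z m w = i] : set (history k)).
Proof.
by move=> mk; apply: sub_sigma_algebra; exists m => //; left; exists i.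
Qed.

Lemma history_state_fun k m d' (E : measurableType d') (u : S -> E) : (m <= k)%N ->
  measurable_fun setT (u \o Z m : history k -> E).
Proof. by move=> mk; apply: measurable_fun_fibers => i; exact: history_state. Qed.

(** Conditionally on the history with Z_k = a, the holding time and the next
    state are independent of each other and of the history: splitting along the
    next state, each part is an instance of [integral_product_law], where phi
    is the identity, seen as a map to Omega with the smaller sigma-algebra. *)
Lemma jump_law (i a : S) k (nu : probability (measurableTypeR R) R) (u : S -> \bar R)
    (A : set Omega) (F : history k * measurableTypeR R -> \bar R) :
  (forall B, nu B = exponential_prob (rate q a) B) ->
  (forall b, 0 <= u b)%E ->
  measurable (A : set (history k)) ->
  measurable_fun setT F -> (forall z, 0 <= F z)%E ->
  (\int[P i]_(w in A `&` [set w | Z k w = a])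
      (F (w, (T k.+1 w - T k w)%R) * u (Z k.+1 w)) =
   (\esum_(b in [set~ a]) ((q a b / rate q a)%:E * u b)) *
   \int[P i]_(w in A `&` [set w | Z k w = a]) \int[nu]_y F (w, y))%E.
Proof.
move=> nuE u0 mA mF F0.
have mD : measurable ((A : set (history k)) `&` [set w | Z k w = a]).
  by apply: measurableI => //; exact: history_state.
have mD' := history_measurable mD.
have mY : measurable_fun setT (fun w => T k.+1 w - T k w).
  by apply: measurable_funB; exact: (jump_time_measurable XT_chain).
have mid : measurable_fun setT (id : Omega -> history k).
  by move=> _ B mB; rewrite setTI; exact: history_measurable mB.
have mFY : measurable_fun setT (fun w => F (w, T k.+1 w - T k w)).
  apply: (measurableT_comp (f := F)) => //.
  exact: measurable_fun_pair.
have mu : measurable_fun setT (fun w => u (Z k.+1 w)).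
  by apply: measurable_fun_fibers => j; exact: (jump_state_measurable XT_chain).
have in0 w : (0 <= \int[nu]_y F (w, y))%E by apply: integral_ge0.
rewrite (ge0_integral_fibers _ (jump_state_measurable XT_chain k.+1)) //; last 2 first.
- by apply: measurable_funTS; exact: emeasurable_funM.
- by move=> w _; apply: mule_ge0.
rewrite muleC -ge0_esumZl; last 2 first.
- exact: integral_ge0.
- move=> b ba; rewrite mule_ge0// lee_fin divr_ge0//.
    by apply: (intensity_ge0 XT_chain); apply/eqP.
  exact/ltW/(rate_gt0 XT_chain).
rewrite [RHS]esum_mkcond; apply: eq_esum => b _.
case: ifPn => [|/negP]; rewrite inE/=; last first.
  move=> /contrapT ->; rewrite (_ : _ `&` _ = set0) ?integral_set0//.
  rewrite -subset0 => w [[_ /= wk] wk1].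
  by apply: (jump_neq XT_chain (k := k) (w := w)); rewrite wk.
move=> /eqP ba.
transitivity (\int[P i]_(w in A `&` [set w | Z k w = a] `&` [set w | Z k.+1 w = b])
    (u b * F (w, (T k.+1 w - T k w)%R)))%E.
  by apply: eq_integral => w /[!inE] -[_ /= ->]; rewrite muleC.
have mDb := measurableI _ _ mD' (jump_state_measurable XT_chain k.+1 b).
rewrite ge0_integralZl//; last exact: measurable_funTS.
have p0 : 0 <= q a b / rate q a.
  by rewrite divr_ge0 ?(intensity_ge0 XT_chain)// ltW// (rate_gt0 XT_chain).
rewrite (integral_product_law (phi := id : Omega -> history k) (nu := nu) mid mY p0 mD' mDb _ mF F0).
  by rewrite muleA muleC; congr (_ * _)%E; rewrite muleC.
move=> B C mB mC; rewrite nuE.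
have := @chain_law _ _ _ _ _ _ _ _ XT_chain i k (B `&` A) a b C _ ba mC.
rewrite jump_historyE => /(_ (measurableI _ _ mB mA)) H.
rewrite -[X in P i X = _](_ : (B `&` A) `&` [set w | [/\ Z k w = a, Z k.+1 w = b
   & C (T k.+1 w - T k w)]] = _); last first.
  by apply/seteqP; split => w /= => [[[? ?] []]|[[[? ?] ?] []]].
by rewrite H muleAC [X in (X * _)%E]muleC -setIA [B `&` _]setIC.
Qed.

(** For alpha < q_a, the expected cost of waiting for the next jump if u is to
    be paid there: the discounted holding time contributes q_a / (q_a - alpha)
    and the next state is b with probability q_ab / q_a. *)
Definition continue_cost (u : S -> \bar R) (a : S) : \bar R :=
  (\esum_(b in [set~ a]) ((q a b / (rate q a - alpha))%:E * u b))%E.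

Definition bellman (u : S -> \bar R) (a : S) : \bar R :=
  if rate q a <= alpha then (G a)%:E else mine (G a)%:E (continue_cost u a).

Lemma jump_prob_sum a :
  (\esum_(b in [set~ a]) (q a b / rate q a)%:E = 1%:E)%E.
Proof.
have r0 := rate_gt0 XT_chain a.
under eq_esum do rewrite mulrC EFinM.
rewrite ge0_esumZl ?(intensity_row_sum XT_chain)//.
- by rewrite -EFinM mulVf// gt_eqF.
- by rewrite lee_fin invr_ge0 ltW.
- by move=> b /eqP ba; rewrite lee_fin (intensity_ge0 XT_chain).
Qed.

(** As the total mass is finite, changing u by a small constant changes
    [continue_cost u] little. *)
Lemma continue_mass a : alpha < rate q a ->
  (\esum_(b in [set~ a]) (q a b / (rate q a - alpha))%:E =
   (rate q a / (rate q a - alpha))%:E)%E.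
Proof.
move=> ar; have ra0 : 0 < rate q a - alpha by rewrite subr_gt0.
under eq_esum do rewrite mulrC EFinM.
rewrite ge0_esumZl ?(intensity_row_sum XT_chain)//.
- by rewrite -EFinM mulrC.
- by rewrite lee_fin invr_ge0 ltW.
- by move=> b /eqP ba; rewrite lee_fin (intensity_ge0 XT_chain).
Qed.

Lemma continue_cost_gt0 (u : S -> \bar R) a :
  alpha < rate q a -> (forall b, 0 < u b)%E -> (0 < continue_cost u a)%E.
Proof.
move=> ar u0; apply: esum_mul_gt0 => //.
  move=> b /eqP ba; rewrite lee_fin divr_ge0 ?(intensity_ge0 XT_chain)//.
  by rewrite subr_ge0 ltW.
by rewrite continue_mass// lte_fin divr_gt0 ?(rate_gt0 XT_chain)// subr_gt0.
Qed.

(** The right-hand side is the expected cost of the delay h in state a.  For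
    alpha < q_a it is a convex combination of G a and of [continue_cost u a].
    For q_a <= alpha, its first term is at least G a if h is finite, and if h is
    infinite its second term is infinite, as u is positive. *)
Lemma bellman_le_one_jump (nu : probability (measurableTypeR R) R) (a : S)
    (u : S -> \bar R) (h : \bar R) :
  (forall B, nu B = exponential_prob (rate q a) B) ->
  (forall b, 0 < u b)%E -> (0 <= h)%E ->
  (bellman u a <= (expR (alpha * fine h) * G a * survival (rate q a) h)%:E
    + (\esum_(b in [set~ a]) ((q a b / rate q a)%:E * u b)) *
      \int[nu]_(y in [set y | (y%:E <= h)%E]) (expR (alpha * y))%:E)%E.
Proof.
move=> nuE u0 h0; have r0 := rate_gt0 XT_chain a.
set K := (\esum_(b in _) _)%E.
have p0 b : b != a -> 0 <= q a b / rate q a.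
  by move=> ba; rewrite divr_ge0 ?(intensity_ge0 XT_chain)// ltW.
have K0 : (0 <= K)%E.
  apply: esum_ge0 => b /eqP ba; apply: mule_ge0; last exact: ltW.
  by rewrite lee_fin p0.
have Kgt0 : (0 < K)%E.
  apply: esum_mul_gt0 => //; last by rewrite jump_prob_sum.
  by move=> b /eqP ba; rewrite lee_fin p0.
have I0 : (0 <= \int[nu]_(y in [set y | (y%:E <= h)%E]) (expR (alpha * y))%:E)%E.
  by apply: integral_ge0 => y _; rewrite lee_fin expR_ge0.
rewrite /bellman; case: ifPn => [ra|].
  case: h h0 I0 => [h| |]// h0 I0; last first.
    rewrite (_ : [set _ | _] = setT); last first.
      by apply/seteqP; split => // y _ /=; rewrite leey.
    rewrite (exponential_discount_infty nuE)// gt0_muley// addey//.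
    by rewrite leey.
  rewrite -[leLHS]adde0 leeD ?mule_ge0// lee_fin /= mulrAC -expRD mulNr -mulrBl.
  rewrite ler_peMl ?(ltW (G0 a))//.
  by rewrite -[X in X <= _]expR0 ler_expR mulr_ge0 ?subr_ge0// -lee_fin.
rewrite -ltNge => ar; have ra0 : 0 < rate q a - alpha by rewrite subr_gt0.
rewrite (exponential_discount nuE)//.
set s := survival (rate q a - alpha) h.
(* For h = +oo both sides vanish. *)
have sE : expR (alpha * fine h) * G a * survival (rate q a) h = G a * s.
  rewrite /s; case: (h) => [x| |]; rewrite /survival/= ?mulr0//.
  by rewrite mulrAC -expRD [LHS]mulrC; congr (_ * expR _); ring.
rewrite sE.
have s0 : 0 <= s by rewrite /s /survival; case: (h) => // x; exact: expR_ge0.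
have s1 : s <= 1.
  rewrite /s /survival; case: (h) h0 => // x; rewrite lee_fin => x0.
  by rewrite -[leRHS]expR0 ler_expR mulNr oppr_le0 mulr_ge0// ltW.
have -> : (K * (rate q a / (rate q a - alpha) * (1 - s))%:E =
    continue_cost u a * (1 - s)%:E)%E.
  rewrite EFinM muleA; congr (_ * _)%E; rewrite muleC /K /continue_cost.
  rewrite -ge0_esumZl; last 2 first.
  - by rewrite lee_fin divr_ge0// ltW.
  - by move=> b /eqP ba; apply: mule_ge0; [rewrite lee_fin p0|exact: ltW].
  apply: eq_esum => b _; rewrite muleA -EFinM; congr (_%:E * _)%E.
  by rewrite mulrAC mulrCA mulfV ?gt_eqF// mulr1 mulrC.
set c := continue_cost u a.
have c0 : (0 <= c)%E.
  apply: esum_ge0 => b /eqP ba; apply: mule_ge0; last exact: ltW.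
  by rewrite lee_fin divr_ge0 ?(intensity_ge0 XT_chain)// ltW.
have [m mE] : exists m, mine (G a)%:E c = m%:E.
  case: (c) c0 => [x| |]// _; first by exists (Num.min (G a) x); rewrite EFin_min.
  by exists (G a); rewrite miney.
have mG : m <= G a by rewrite -lee_fin -mE ge_min lexx.
have mc : (m%:E <= c)%E by rewrite -mE ge_min lexx orbT.
(* The minimum is split with the weights s and 1 - s; being finite, it is
   not affected by a weight 0 next to an infinite c. *)
have -> : mine (G a)%:E c = ((m * s)%:E + m%:E * (1 - s)%:E)%E.
  by rewrite mE -EFinM -EFinD -mulrDr addrC subrK mulr1.
apply: leeD; first by rewrite lee_fin ler_wpM2r.
by apply: lee_wpmul2r => //; rewrite lee_fin subr_ge0.
Qed.

Definition stops (H : Omega -> \bar R) (k : nat) : set Omega :=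
  [set w | ((T k w)%:E + H w < (T k.+1 w)%:E)%E].

Lemma stopsE H k w : stops H k w = (H w < (T k.+1 w - T k w)%:E)%E :> Prop.
Proof. by rewrite /stops/= EFinB lteBrDl. Qed.

Lemma history_time_next k (f : R -> R) : measurable_fun setT f ->
  measurable_fun setT (fun z : history k * measurableTypeR R => f (T k z.1 + z.2)).
Proof.
move=> mf; apply: measurableT_comp => //.
apply: measurable_funD; last exact: measurable_snd.
by apply: (measurableT_comp (f := T k : history k -> R)) => //; exact: history_time.
Qed.

(** [jump_law], where F is the discount factor at the next jump, cut off where
    the delay H has run out before. *)
Lemma jump_integral (i a : S) k (A : set Omega) (H : Omega -> \bar R) (u : S -> \bar R)
    (nu : probability (measurableTypeR R) R) :
  (forall B, nu B = exponential_prob (rate q a) B) ->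
  measurable (A : set (history k)) ->
  measurable_fun setT (H : history k -> \bar R) ->
  (forall b, 0 <= u b)%E ->
  (\int[P i]_(w in (A `&` [set w | Z k w = a]) `&` ~` stops H k)
      ((expR (alpha * T k.+1 w))%:E * u (Z k.+1 w)) =
   \int[P i]_(w in A `&` [set w | Z k w = a])
      ((expR (alpha * T k w))%:E *
       ((\esum_(b in [set~ a]) ((q a b / rate q a)%:E * u b)) *
        \int[nu]_(y in [set y | (y%:E <= H w)%E]) (expR (alpha * y))%:E)))%E.
Proof.
move=> nuE mA mH u0.
have mexp : measurable_fun setT (fun x : R => expR (alpha * x)).
  by apply: measurableT_comp => //; exact: mulrl_measurable.
pose E := [set z : history k * measurableTypeR R | (z.2%:E <= H z.1)%E].
pose F := (fun z : history k * measurableTypeR R =>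
   (expR (alpha * (T k z.1 + z.2)))%:E) \_ E.
have mE : measurable E.
  rewrite -[E]setTI; apply: measurable_lee => //.
    by apply/measurable_EFinP; exact: measurable_snd.
  exact: (measurableT_comp (f := H : history k -> \bar R)).
have mF : measurable_fun setT F.
  apply: (measurable_restrictT _ mE).1; apply: measurable_funTS.
  apply/measurable_EFinP.
  exact: (history_time_next (f := fun x => expR (alpha * x))).
have F0 z : (0 <= F z)%E.
  by apply: erestrict_ge0 => y _; rewrite lee_fin expR_ge0.
have mI := measurable_fun_fubini_tonelli_F (m2 := nu) F mF F0.
rewrite integral_mkcondr.
transitivity (\int[P i]_(w in A `&` [set w | Z k w = a])
      (F (w, (T k.+1 w - T k w)%R) * u (Z k.+1 w)))%E.
  apply: eq_integral => w _; rewrite /F !patchE /E.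
  have -> : (w \in ~` stops H k) =
      ((w, T k.+1 w - T k w) \in [set z : Omega * R | (z.2%:E <= H z.1)%E]).
    apply/idP/idP; rewrite !inE /= stopsE; first by move=> /negP; rewrite -leNgt.
    by rewrite leNgt => /negP.
  by case: ifPn => _; rewrite /= ?mul0e// addrC subrK.
rewrite (jump_law _ nuE)// -ge0_integralZl//; last 4 first.
- by apply: history_measurable; apply: measurableI mA _; exact: history_state.
- apply: measurable_funTS; apply: history_fun_measurable; exact: mI.
- by move=> w _; apply: integral_ge0.
- apply: esum_ge0 => b /eqP ba; apply: mule_ge0 => //.
  by rewrite lee_fin divr_ge0 ?(intensity_ge0 XT_chain)// ltW// (rate_gt0 XT_chain).
apply: eq_integral => w _.
rewrite [RHS]muleCA; congr (_ * _)%E.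
rewrite [X in (_ * X)%E]integral_mkcond -ge0_integralZl//; last 2 first.
- apply: (measurable_restrictT _ (measurable_le_cst _)).1.
  by apply: measurable_funTS; exact/measurable_EFinP.
- by move=> y _; apply: erestrict_ge0 => x _; rewrite lee_fin expR_ge0.
apply: eq_integral => y _; rewrite /F !patchE /E.
have -> : ((w, y) \in [set z : Omega * R | (z.2%:E <= H z.1)%E]) =
   (y \in [set y | (y%:E <= H w)%E]) by apply/idP/idP; rewrite !inE.
by case: ifPn => _; rewrite ?mule0//= mulrDr expRD.
Qed.

(** [jump_law] with u = 1, where F is the cost of stopping, cut off where the
    next jump comes first. *)
Lemma stop_integral (i a : S) k (A : set Omega) (H : Omega -> \bar R) :
  measurable (A : set (history k)) ->
  measurable_fun setT (H : history k -> \bar R) ->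
  (forall w, 0 <= H w)%E ->
  (\int[P i]_(w in (A `&` [set w | Z k w = a]) `&` stops H k)
      (expR (alpha * fine ((T k w)%:E + H w)%E) * G (Z k w))%:E =
   \int[P i]_(w in A `&` [set w | Z k w = a])
      ((expR (alpha * T k w))%:E *
       (expR (alpha * fine (H w)) * G a * survival (rate q a) (H w))%:E))%E.
Proof.
move=> mA mH H0.
have [nu nuE] := exponential_probability (rate_gt0 XT_chain a).
have mexp : measurable_fun setT (fun x : R => expR (alpha * x)).
  by apply: measurableT_comp => //; exact: mulrl_measurable.
have mfH : measurable_fun setT (fine \o H : history k -> R) by apply: measurableT_comp.
pose E := [set z : history k * measurableTypeR R | (H z.1 < z.2%:E)%E].
pose F := (fun z : history k * measurableTypeR R =>
   (expR (alpha * (T k z.1 + fine (H z.1))) * G a)%:E) \_ E.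
have mE : measurable E.
  rewrite -[E]setTI; apply: measurable_lte => //.
    exact: (measurableT_comp (f := H : history k -> \bar R)).
  by apply/measurable_EFinP; exact: measurable_snd.
have mF : measurable_fun setT F.
  apply: (measurable_restrictT _ mE).1; apply: measurable_funTS.
  apply/measurable_EFinP.
  apply: measurable_funM => //.
  apply: (measurableT_comp (f := fun x => expR (alpha * x))) => //.
  apply: measurable_funD.
    apply: (measurableT_comp (f := T k : history k -> R)) => //; exact: history_time.
  exact: (measurableT_comp (f := fine \o H : history k -> R)).
have F0 z : (0 <= F z)%E.
  by apply: erestrict_ge0 => y _; rewrite lee_fin mulr_ge0 ?expR_ge0// ltW.
rewrite integral_mkcondr.
transitivity (\int[P i]_(w in A `&` [set w | Z k w = a])
      (F (w, (T k.+1 w - T k w)%R) * (fun=> 1%:E) (Z k.+1 w)))%E.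
  apply: eq_integral => w /[!inE] -[_ /= Zw]; rewrite mule1 /F !patchE /E Zw.
  have -> : (w \in stops H k) =
      ((w, T k.+1 w - T k w) \in [set z : Omega * R | (H z.1 < z.2%:E)%E]).
    by apply/idP/idP; rewrite !inE /= stopsE.
  case: ifPn => //; rewrite inE /= => Hlt; rewrite fineD// fin_numE.
  by case: (H w) (H0 w) Hlt.
rewrite (jump_law i (u := fun=> 1%:E) nuE _ mA mF F0); last by move=> b; rewrite lee_fin.
under [X in (X * _)%E]eq_esum do rewrite mule1.
rewrite jump_prob_sum mul1e.
apply: eq_integral => w _.
transitivity (\int[nu]_(y in [set y | (H w < y%:E)%E])
   (expR (alpha * (T k w + fine (H w))) * G a)%:E)%E.
  rewrite [RHS]integral_mkcond; apply: eq_integral => y _; rewrite /F !patchE /E.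
  have -> : ((w, y) \in [set z : Omega * R | (H z.1 < z.2%:E)%E]) =
    (y \in [set y | (H w < y%:E)%E]) by apply/idP/idP; rewrite !inE.
  by [].
have mHw : measurable [set y : measurableTypeR R | (H w < y%:E)%E].
  rewrite (_ : [set _ | _] = ~` [set y | (y%:E <= H w)%E]).
    by apply: measurableC; exact: measurable_le_cst.
  by apply/seteqP; split => y /=; rewrite ltNge => /negP.
rewrite integral_cst// -[X in (_ * X)%E]/(nu _) nuE exponential_survival ?(rate_gt0 XT_chain)//.
by rewrite -!EFinM; congr EFin; rewrite mulrDr expRD !mulrA.
Qed.

Lemma stops_history k (H : Omega -> \bar R) :
  measurable_fun setT (H : history k -> \bar R) ->
  measurable (stops H k : set (history k.+1)).
Proof.
move=> mH; rewrite -[X in measurable X]setTI.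
have mT m : (m <= k.+1)%N -> measurable_fun setT (EFin \o T m : history k.+1 -> \bar R).
  by move=> mk; apply/measurable_EFinP; exact: history_time.
apply: (measurable_lte (T := history k.+1)) => //; last exact: (mT k.+1).
apply: emeasurable_funD; first exact: (mT k).
exact: history_fun_le (leqnSn k) mH.
Qed.

(** As a function of its bound, the integral is a section integral of a
    measurable function of two variables. *)
Lemma measurable_truncated_discount (nu : probability (measurableTypeR R) R) :
  measurable_fun setT (fun h : \bar R =>
    \int[nu]_(y in [set y | (y%:E <= h)%E]) (expR (alpha * y))%:E)%E.
Proof.
pose E := [set z : \bar R * measurableTypeR R | (z.2%:E <= z.1)%E].
pose F := (fun z : \bar R * measurableTypeR R => (expR (alpha * z.2))%:E) \_ E.
have mE : measurable E.
  rewrite -[E]setTI; apply: measurable_lee => //.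
  by apply/measurable_EFinP; exact: measurable_snd.
have mF : measurable_fun setT F.
  apply: (measurable_restrictT _ mE).1; apply: measurable_funTS.
  apply/measurable_EFinP; apply: measurableT_comp => //.
  by apply: measurable_funM => //; exact: measurable_snd.
have F0 z : (0 <= F z)%E.
  by apply: erestrict_ge0 => y _; rewrite lee_fin expR_ge0.
apply: eq_measurable_fun (measurable_fun_fubini_tonelli_F (m2 := nu) F mF F0).
move=> h _; rewrite /fubini_F [RHS]integral_mkcond; apply: eq_integral => y _.
rewrite /F !patchE /E.
have -> : ((h, y) \in [set z : \bar R * R | (z.2%:E <= z.1)%E]) =
   (y \in [set y | (y%:E <= h)%E]) by apply/idP/idP; rewrite !inE.
by [].
Qed.

Lemma measurable_discount m : measurable_fun setT (fun w => (expR (alpha * T m w))%:E).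
Proof.
apply/measurable_EFinP; apply: measurableT_comp => //.
apply: measurable_funM => //; exact: (jump_time_measurable XT_chain).
Qed.

Lemma measurable_discounted m (u : S -> \bar R) :
  measurable_fun setT (fun w => (expR (alpha * T m w))%:E * u (Z m w))%E.
Proof.
apply: emeasurable_funM; first exact: measurable_discount.
by apply: measurable_fun_fibers => a; exact: (jump_state_measurable XT_chain).
Qed.

Lemma measurable_stop_cost k (H : Omega -> \bar R) :
  measurable_fun setT (H : history k -> \bar R) ->
  measurable_fun setT (fun w => (expR (alpha * fine ((T k w)%:E + H w)%E) * G (Z k w))%:E).
Proof.
move=> mH; apply/measurable_EFinP; apply: measurable_funM.
  apply: measurableT_comp => //; apply: measurable_funM => //.
  apply: (measurableT_comp (f := fine)) => //; apply: emeasurable_funD.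
    by apply/measurable_EFinP; exact: (jump_time_measurable XT_chain).
  exact: (history_fun_measurable mH).
by apply: measurable_fun_fibers => a; exact: (jump_state_measurable XT_chain).
Qed.

Lemma continue_cost_ge0 (u : S -> \bar R) a :
  alpha < rate q a -> (forall b, 0 <= u b)%E -> (0 <= continue_cost u a)%E.
Proof.
move=> ra u0; apply: esum_ge0 => b /eqP ba; apply: mule_ge0 => //.
by rewrite lee_fin divr_ge0 ?(intensity_ge0 XT_chain)// subr_ge0 ltW.
Qed.

Lemma bellman_ge0 (u : S -> \bar R) a : (forall b, 0 <= u b)%E -> (0 <= bellman u a)%E.
Proof.
move=> u0; rewrite /bellman; case: ifPn => [_|]; first by rewrite lee_fin ltW.
by rewrite -ltNge => ra; rewrite le_min lee_fin ltW// continue_cost_ge0.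
Qed.

(** Integrating [bellman_le_one_jump] over the history, for a delay that is a
    function of the history.  After splitting along Z_k, both terms on the right
    become integrals over the same event. *)
Lemma bellman_integral_le i k (A : set Omega) (H : Omega -> \bar R) (u : S -> \bar R) :
  measurable (A : set (history k)) ->
  measurable_fun setT (H : history k -> \bar R) ->
  (forall w, 0 <= H w)%E -> (forall b, 0 < u b)%E ->
  (\int[P i]_(w in A) ((expR (alpha * T k w))%:E * bellman u (Z k w)) <=
   \int[P i]_(w in A `&` stops H k)
      (expR (alpha * fine ((T k w)%:E + H w)%E) * G (Z k w))%:E +
   \int[P i]_(w in A `&` ~` stops H k)
      ((expR (alpha * T k.+1 w))%:E * u (Z k.+1 w)))%E.
Proof.
move=> mA mH H0 u0; have u0' b := ltW (u0 b).
have mA' := history_measurable mA.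
have mS := history_measurable (stops_history mH).
have mSC := measurableC mS.
have mZ := jump_state_measurable XT_chain k.
have cost0 w : (0 <= (expR (alpha * fine ((T k w)%:E + H w)%E) * G (Z k w))%:E)%E.
  by rewrite lee_fin mulr_ge0 ?expR_ge0// ltW.
have disc0 m (v : S -> \bar R) w : (forall b, 0 <= v b)%E ->
    (0 <= (expR (alpha * T m w))%:E * v (Z m w))%E.
  by move=> v0; rewrite mule_ge0// lee_fin expR_ge0.
rewrite (ge0_integral_fibers _ mZ mA'); last 2 first.
- by apply: measurable_funTS; exact: measurable_discounted.
- by move=> w _; apply: disc0 => b; exact: bellman_ge0.
rewrite (ge0_integral_fibers _ mZ (measurableI _ _ mA' mS)); last 2 first.
- by apply: measurable_funTS; exact: measurable_stop_cost.
- by move=> w _.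
rewrite (ge0_integral_fibers _ mZ (measurableI _ _ mA' mSC)); last 2 first.
- by apply: measurable_funTS; exact: measurable_discounted.
- by move=> w _; apply: disc0.
rewrite -esumD; last 2 first.
- by move=> a _; apply: integral_ge0.
- by move=> a _; apply: integral_ge0 => w _; apply: disc0.
apply: le_esum => a _; rewrite (setIAC A (stops H k)) (setIAC A (~` stops H k)).
have [nu nuE] := exponential_probability (rate_gt0 XT_chain a).
rewrite stop_integral// (jump_integral i nuE)//.
have mD := measurableI _ _ mA' (mZ a).
have r0 := rate_gt0 XT_chain a.
have K0 : (0 <= \esum_(b in [set~ a]) ((q a b / rate q a)%:E * u b))%E.
  apply: esum_ge0 => b /eqP ba; apply: mule_ge0 => //.
  by rewrite lee_fin divr_ge0 ?(intensity_ge0 XT_chain)// ltW.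
set K := (\esum_(b in _) _)%E in K0 *.
have I0 w : (0 <= \int[nu]_(y in [set y | (y%:E <= H w)%E]) (expR (alpha * y))%:E)%E.
  by apply: integral_ge0 => y _; rewrite lee_fin expR_ge0.
have s0 w : (0 <= (expR (alpha * fine (H w)) * G a * survival (rate q a) (H w))%:E)%E.
  rewrite lee_fin; apply: mulr_ge0; first by rewrite mulr_ge0 ?expR_ge0 ?(ltW (G0 a)).
  by rewrite /survival; case: (H w).
have e0 w : (0 <= (expR (alpha * T k w))%:E)%E by rewrite lee_fin expR_ge0.
have ms : measurable_fun setT (fun w =>
    (expR (alpha * fine (H w)) * G a * survival (rate q a) (H w))%:E).
  have mH' := history_fun_measurable mH.
  apply/measurable_EFinP; apply: measurable_funM.
    apply: measurable_funM => //; apply: measurableT_comp => //.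
    by apply: measurable_funM => //; exact: measurableT_comp.
  have -> : (fun w => survival (rate q a) (H w)) =
      (fun w => expR (- rate q a * fine (H w)) * \1_[set w | (H w < +oo)%E] w).
    apply/funext => w; rewrite /survival indicE.
    have -> : (w \in [set w | (H w < +oo)%E]) = (H w < +oo)%E.
      by apply/idP/idP; rewrite inE.
    by case: (H w) (H0 w) => [x| |]//= _; rewrite ?ltry ?ltxx ?mulr1 ?mulr0.
  apply: measurable_funM.
    by apply: measurableT_comp => //; apply: measurable_funM => //; exact: measurableT_comp.
  by apply: measurable_indic; rewrite -[X in measurable X]setTI; exact: emeasurable_fun_infty_o.
have mI : measurable_fun setT (fun w => \int[nu]_(y in [set y | (y%:E <= H w)%E])
    (expR (alpha * y))%:E)%E.
  exact: measurableT_comp (measurable_truncated_discount nu)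
    (history_fun_measurable mH).
rewrite -ge0_integralD//; last 4 first.
- by move=> w _; apply: mule_ge0.
- by apply: measurable_funTS; apply: emeasurable_funM => //; exact: measurable_discount.
- by move=> w _; rewrite !mule_ge0.
- apply: measurable_funTS; apply: emeasurable_funM; first exact: measurable_discount.
  by apply: emeasurable_funM.
apply: ge0_le_integral => //.
- by move=> w _; apply: disc0 => b; exact: bellman_ge0.
- by apply: measurable_funTS; exact: measurable_discounted.
- apply: measurable_funTS; apply: emeasurable_funD; apply: emeasurable_funM => //.
  + exact: measurable_discount.
  + exact: measurable_discount.
  + by apply: emeasurable_funM.
move=> w [_ /= ->]; rewrite -ge0_muleDr//; last by rewrite mule_ge0.
by apply: lee_wpmul2l => //; exact: bellman_le_one_jump.
Qed.

(** [jump_integral] for an infinite delay, where the discounted holding time has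
    a finite mean because of the condition on the rates. *)
Lemma continue_integral i k (A : set Omega) (u : S -> \bar R) :
  measurable (A : set (history k)) ->
  (forall w, A w -> alpha < rate q (Z k w)) -> (forall b, 0 <= u b)%E ->
  (\int[P i]_(w in A) ((expR (alpha * T k.+1 w))%:E * u (Z k.+1 w)) =
   \int[P i]_(w in A) ((expR (alpha * T k w))%:E * continue_cost u (Z k w)))%E.
Proof.
move=> mA rA u0; have mA' := history_measurable mA.
have mZ := jump_state_measurable XT_chain k.
rewrite (ge0_integral_fibers _ mZ mA'); last 2 first.
- by apply: measurable_funTS; exact: measurable_discounted.
- by move=> w _; rewrite mule_ge0// lee_fin expR_ge0.
rewrite (ge0_integral_fibers _ mZ mA'); last 2 first.
- by apply: measurable_funTS; exact: measurable_discounted.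
- by move=> w Aw; rewrite mule_ge0 ?lee_fin ?expR_ge0// continue_cost_ge0// rA.
apply: eq_esum => a _.
have [[w0 [Aw0 /= Zw0]]|H] := pselect (exists w, A w /\ Z k w = a); last first.
  rewrite (_ : A `&` _ = set0) ?integral_set0// -subset0 => w [Aw Zw].
  by apply: H; exists w.
have ra : alpha < rate q a by rewrite -Zw0 rA.
have r0 := rate_gt0 XT_chain a; have [nu nuE] := exponential_probability r0.
have stopsy : stops (fun=> +oo%E) k = set0 :> set Omega.
  by rewrite -subset0 => w; rewrite /stops/= addey// ltNge leey.
transitivity (\int[P i]_(w in (A `&` [set w | Z k w = a]) `&` ~` stops (fun=> +oo%E) k)
    ((expR (alpha * T k.+1 w))%:E * u (Z k.+1 w)))%E.
  by rewrite stopsy setC0 setIT.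
rewrite (jump_integral i nuE)//.
rewrite (exponential_discount nuE r0 ra)// subr0 mulr1.
apply: eq_integral => w /[!inE] -[_ /= ->]; congr (_ * _)%E.
rewrite muleC -ge0_esumZl; last 2 first.
- by rewrite lee_fin divr_ge0 ?subr_ge0// ltW.
- move=> b /eqP ba; apply: mule_ge0 => //.
  by rewrite lee_fin divr_ge0 ?(intensity_ge0 XT_chain)// ltW.
apply: eq_esum => b _; rewrite muleA -EFinM; congr (_%:E * _)%E.
by rewrite mulrAC mulrCA mulfV ?gt_eqF// mulr1 mulrC.
Qed.

(** * Stopping rules *)

Definition rule_stops (H : nat -> Omega -> \bar R) (w : Omega) (k : nat) : bool :=
  ((T k w)%:E + H k w < (T k.+1 w)%:E)%E.

(** A rule H prescribes, when the k-th jump has occurred, the delay H k after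
    which one stops unless a further jump comes first.  With delays that depend
    on time and on the current state only, this is [markovian_time]. *)
Definition rule_time (H : nat -> Omega -> \bar R) (w : Omega) : \bar R :=
  match pselect (exists k, rule_stops H w k) with
  | left s => let k := ex_minn s in ((T k w)%:E + H k w)%E
  | right _ => +oo%E
  end.

Definition adapted_rule (H : nat -> Omega -> \bar R) :=
  forall k, measurable_fun setT (H k : history k -> \bar R) /\
    forall w, (0 <= H k w)%E.

Definition stop_cost (t : \bar R) (w : Omega) : R :=
  expR (alpha * fine t) * G (X (fine t) w).

(** The cost of following H from the k-th jump on for n jumps, after which psi
    is paid.  For psi = G this is the rule truncated at the jump k + n; for
    psi = 0 it is the part of the cost that is due to stopping before that
    jump, which increases to the total cost with n. *)
Fixpoint payoff (psi : S -> R) (H : nat -> Omega -> \bar R) (k n : nat)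
    (w : Omega) : R :=
  if n is n'.+1 then
    if rule_stops H w k then expR (alpha * fine ((T k w)%:E + H k w)%E) * G (Z k w)
    else payoff psi H k.+1 n' w
  else expR (alpha * T k w) * psi (Z k w).

Lemma time_le m n w : (m <= n)%N -> T m w <= T n w.
Proof.
move=> mn; apply: (homo_leq_in (D := predT) (f := T^~ w) (r := fun x y => x <= y)) => //.
- by move=> y x z; exact: le_trans.
- by move=> i _ _; exact/ltW/(jump_time_lt XT_chain).
Qed.

Lemma time_ge0 n w : 0 <= T n w.
Proof. by rewrite -(jump_time0 XT_chain w); exact: time_le. Qed.

Lemma rule_time_stop H w k : rule_stops H w k ->
  (forall m, (m < k)%N -> ~~ rule_stops H w m) ->
  rule_time H w = ((T k w)%:E + H k w)%E.
Proof.
move=> sk nsm; rewrite /rule_time; case: pselect => [s|]; last by case; exists k.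
case: ex_minnP => m sm minm; suff -> : m = k by [].
apply/eqP; rewrite eqn_leq minm//= leqNgt; apply/negP => mk.
by move: (nsm m mk); rewrite sm.
Qed.

Lemma rule_time_infty H w : (forall k, ~~ rule_stops H w k) -> rule_time H w = +oo%E.
Proof.
move=> ns; rewrite /rule_time; case: pselect => // -[k sk].
by move: (ns k); rewrite sk.
Qed.

Lemma rule_stops_fin H w k : (forall w, (0 <= H k w)%E) -> rule_stops H w k ->
  exists2 h, H k w = h%:E & T k w <= T k w + h < T k.+1 w.
Proof.
move=> /(_ w); rewrite /rule_stops; case: (H k w) => [h| |]//.
by rewrite lee_fin -EFinD lte_fin => h0 hT; exists h; rewrite // lerDl h0.
Qed.

Lemma rule_time_cases H w :
  (exists2 k, rule_stops H w k & forall m, (m < k)%N -> ~~ rule_stops H w m) \/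
  (forall k, ~~ rule_stops H w k).
Proof.
have [s|ns] := pselect (exists k, rule_stops H w k); last first.
  by right => k; apply/negP => sk; apply: ns; exists k.
left; case: (ex_minnP s) => k sk mink; exists k => // m mk.
by apply/negP => /mink; rewrite leqNgt mk.
Qed.

Lemma rule_time_finite H w : adapted_rule H ->
  (rule_time H w < +oo)%E <-> exists k, rule_stops H w k.
Proof.
move=> aH; have [[k sk nsm]|ns] := rule_time_cases H w.
  split => _; first by exists k.
  rewrite (rule_time_stop sk nsm).
  by have [h -> _] := rule_stops_fin (aH k).2 sk; rewrite ltry.
rewrite rule_time_infty// ltxx; split => // -[k sk].
by move: (ns k); rewrite sk.
Qed.

Lemma rule_time_ge0 H w : adapted_rule H -> (0 <= rule_time H w)%E.
Proof.
move=> aH; have [[k sk nsm]|ns] := rule_time_cases H w; last by rewrite rule_time_infty.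
by rewrite (rule_time_stop sk nsm) adde_ge0 ?(aH k).2// lee_fin time_ge0.
Qed.

Lemma stop_cost_rule H w k : (forall w, (0 <= H k w)%E) -> rule_stops H w k ->
  stop_cost ((T k w)%:E + H k w) w =
  expR (alpha * fine ((T k w)%:E + H k w)%E) * G (Z k w).
Proof.
move=> H0 sk; have [h hE hT] := rule_stops_fin H0 sk.
by rewrite /stop_cost hE /= (chain_path XT_chain hT).
Qed.

Lemma payoff_truncated H k n w : adapted_rule H ->
  (forall m, (m < k)%N -> ~~ rule_stops H w m) ->
  stop_cost (mine (rule_time H w) (T (k + n)%N w)%:E) w = payoff G H k n w.
Proof.
move=> aH; elim: n k => [|n IHn] k nsm /=.
  rewrite addn0.
  have -> : mine (rule_time H w) (T k w)%:E = (T k w)%:E.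
    apply/min_idPr; have [[j sj nsj]|ns] := rule_time_cases H w; last first.
      by rewrite rule_time_infty// leey.
    rewrite (rule_time_stop sj nsj); have [h hE /andP[hT _]] := rule_stops_fin (aH j).2 sj.
    rewrite hE lee_fin; apply: le_trans hT; apply: time_le.
    by rewrite leqNgt; apply/negP => /nsm; rewrite sj.
  by rewrite /stop_cost/=.
case: ifPn => sk; last first.
  rewrite addnS -addSn IHn// => m; rewrite ltnS leq_eqVlt => /predU1P[->//|].
  exact: nsm.
rewrite (rule_time_stop sk nsm) -(stop_cost_rule (aH k).2 sk).
have [h hE /andP[_ hT]] := rule_stops_fin (aH k).2 sk.
congr stop_cost; apply/min_idPl; rewrite hE lee_fin; apply/ltW.
by apply: lt_le_trans hT _; apply: time_le; rewrite addnS -addSn leq_addr.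
Qed.

Lemma payoff_stopped psi H w j k n : adapted_rule H ->
  rule_stops H w (k + j) ->
  (forall m, (m < k + j)%N -> ~~ rule_stops H w m) -> (j < n)%N ->
  payoff psi H k n w = stop_cost (rule_time H w) w.
Proof.
move=> aH; elim: n j k => // n IHn [|j] k; rewrite ?addn0 => sk nsm jn /=.
  by rewrite sk (rule_time_stop sk nsm) (stop_cost_rule (aH k).2 sk).
rewrite (negbTE (nsm k _)) ?addnS ?ltnS ?leq_addr// (IHn j)// ?addSnnS//.
Qed.

Lemma payoff_never psi H w k n : (forall m, ~~ rule_stops H w m) ->
  payoff psi H k n w = expR (alpha * T (k + n) w) * psi (Z (k + n) w).
Proof.
move=> ns; elim: n k => [|n IHn] k /=; first by rewrite addn0.
by rewrite (negbTE (ns k)) IHn addSnnS.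
Qed.

Lemma payoff_ge0 psi H k n w : (forall a, 0 <= psi a) -> 0 <= payoff psi H k n w.
Proof.
move=> psi0; elim: n k => [|n IHn] k /=; first by rewrite mulr_ge0 ?expR_ge0.
by case: ifPn => // _; rewrite mulr_ge0 ?expR_ge0// ltW.
Qed.

Lemma payoff0_nondecreasing H k w : nondecreasing_seq (fun n => payoff (fun=> 0) H k n w).
Proof.
apply/nondecreasing_seqP => n; elim: n k => [|n IHn] k; last first.
  by rewrite /=; case: ifPn => // _; exact: IHn.
by rewrite [leLHS]/= mulr0 payoff_ge0.
Qed.

Lemma measurable_payoff psi H k n : adapted_rule H ->
  measurable_fun setT (fun w => (payoff psi H k n w)%:E).
Proof.
move=> aH; apply/measurable_EFinP; elim: n k => [|n IHn] k /=.
  apply: measurable_funM; first exact/measurable_EFinP/(measurable_discount).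
  by apply: measurable_fun_fibers => a; exact: (jump_state_measurable XT_chain).
apply: measurable_fun_ifT => //.
  apply: (measurable_fun_bool true); rewrite setTI.
  rewrite (_ : _ @^-1` _ = stops (H k) k)//.
  exact: (history_measurable (stops_history (aH k).1)).
exact/measurable_EFinP/(measurable_stop_cost (aH k).1).
Qed.

Lemma measurable_rule_finite H : adapted_rule H ->
  measurable [set w | (rule_time H w < +oo)%E].
Proof.
move=> aH; rewrite (_ : [set _ | _] = \bigcup_k stops (H k) k).
  apply: bigcup_measurable => k _.
  exact: (history_measurable (stops_history (aH k).1)).
apply/seteqP; split => w /=; first by move=> /(rule_time_finite w aH)[k sk]; exists k.
by move=> [k _ sk]; apply/(rule_time_finite w aH); exists k.
Qed.

Lemma stop_cost_infty w : stop_cost +oo w = G (Z 0%N w).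
Proof. by rewrite /stop_cost/= mulr0 expR0 mul1r /jump_state (jump_time0 XT_chain). Qed.

(** The cost is the limit of the truncated payoffs where the rule stops, and
    elsewhere, as [fine] sends +oo to 0, the cost of stopping at time 0. *)
Lemma measurable_stop_cost_rule H : adapted_rule H ->
  measurable_fun setT (fun w => (stop_cost (rule_time H w) w)%:E).
Proof.
move=> aH; have mF := measurable_rule_finite aH.
(* The second summand accounts for the event that the rule never stops. *)
pose f n w := ((payoff (fun=> 0) H 0 n w)%:E +
  ((fun w => (G (Z 0 w))%:E) \_ (~` [set w | (rule_time H w < +oo)%E])) w)%E.
apply: (emeasurable_fun_cvg f) => [n|w _].
  apply: emeasurable_funD; first exact: measurable_payoff.
  apply: (measurable_restrictT _ (measurableC mF)).1; apply: measurable_funTS.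
  apply: (measurable_fun_fibers (fun a => (G a)%:E)) => a.
  exact: (jump_state_measurable XT_chain).
apply: cvg_near_cst; have [[k sk nsm]|ns] := rule_time_cases H w.
  exists k.+1 => // n /= kn; rewrite /f patchE memNset ?adde0.
    by rewrite (@payoff_stopped (fun=> 0) H w k 0 n).
  by move=> /=; apply; apply/(rule_time_finite w aH); exists k.
near=> n; rewrite /f payoff_never// mulr0 add0e patchE rule_time_infty// mem_set//=.
  by rewrite stop_cost_infty.
by rewrite rule_time_infty// ltxx.
Unshelve. all: by end_near. Qed.

(** By monotone convergence, as the payoffs with psi = 0 increase to the cost
    wherever the rule stops. *)
Lemma integral_stop_cost_le i H (B : \bar R) : adapted_rule H ->
  P i [set w | (rule_time H w < +oo)%E] = 1%E ->
  (forall n, \int[P i]_w (payoff (fun=> 0) H 0 n w)%:E <= B)%E ->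
  (\int[P i]_w (stop_cost (rule_time H w) w)%:E <= B)%E.
Proof.
move=> aH fin le_B; have mF := measurable_rule_finite aH.
have pay0 n w : (0 <= (payoff (fun=> 0) H 0 n w)%:E)%E.
  by rewrite lee_fin payoff_ge0.
have mp n := measurable_payoff (fun=> 0) 0 n aH.
have mono w : {homo (fun n => (payoff (fun=> 0) H 0 n w)%:E) : n m / (n <= m)%N >-> (n <= m)%E}.
  by move=> m n mn; rewrite lee_fin; exact: (payoff0_nondecreasing H 0 w).
have cvgp w : cvgn (fun n => (payoff (fun=> 0) H 0 n w)%:E).
  exact: ereal_nondecreasing_is_cvgn.
have -> : (\int[P i]_w (stop_cost (rule_time H w) w)%:E =
    \int[P i]_w limn (fun n => (payoff (fun=> 0) H 0 n w)%:E))%E.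
  apply: ge0_ae_eq_integral => //.
  - exact: measurable_stop_cost_rule.
  - by apply: (emeasurable_fun_cvg (fun n w => (payoff (fun=> 0) H 0 n w)%:E)) => // w _; exact: cvgp.
  - by move=> w _; rewrite lee_fin mulr_ge0 ?expR_ge0// ltW.
  - by move=> w _; apply: lime_ge => //; exact: nearW.
  exists (~` [set w | (rule_time H w < +oo)%E]); split.
  - exact: measurableC.
  - by apply: (eq_trans (probability_setC (P i) mF)); rewrite fin subee.
  move=> w /= ne fw; apply: ne => _.
  have [[k sk nsm]|ns] := rule_time_cases H w; last first.
    by move: fw; rewrite rule_time_infty// ltxx.
  apply/esym/cvg_lim => //; apply: cvg_near_cst.
  by exists k.+1 => // n /= kn; rewrite (@payoff_stopped (fun=> 0) H w k 0 n).
rewrite monotone_convergence//; apply: lime_le; last exact: nearW.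
apply: ereal_nondecreasing_is_cvgn => m n mn; apply: ge0_le_integral => //.
by move=> w _; exact: mono.
Qed.

(** * Value iteration *)

Definition value_iter (n : nat) : S -> \bar R := iter n bellman (fun a => (G a)%:E).

Definition value_inf (a : S) : \bar R := ereal_inf [set value_iter n a | n in setT].

Lemma bellman_gt0 (u : S -> \bar R) a : (forall b, 0 < u b)%E -> (0 < bellman u a)%E.
Proof.
move=> u0; rewrite /bellman; case: ifPn => [_|]; first by rewrite lte_fin.
by rewrite -ltNge => ra; rewrite lt_min lte_fin G0 (continue_cost_gt0).
Qed.

Lemma value_iter_gt0 n a : (0 < value_iter n a)%E.
Proof. by elim: n a => [|n IHn] a; [rewrite lte_fin|apply: bellman_gt0]. Qed.

Lemma value_inf_ge0 a : (0 <= value_inf a)%E.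
Proof. by apply: le_ereal_inf_tmp => _ [n _ <-]; exact/ltW/value_iter_gt0. Qed.

Lemma value_inf_le n a : (value_inf a <= value_iter n a)%E.
Proof. by apply: ereal_inf_lbound; exists n. Qed.

Lemma value_inf_le_stop a : (value_inf a <= (G a)%:E)%E.
Proof. exact: (value_inf_le 0). Qed.

Lemma value_inf_fin a : value_inf a \is a fin_num.
Proof.
by rewrite ge0_fin_numE ?value_inf_ge0// (le_lt_trans (value_inf_le_stop a))// ltry.
Qed.

Lemma continue_cost_le (u v : S -> \bar R) a : alpha < rate q a ->
  (forall b, u b <= v b)%E -> (continue_cost u a <= continue_cost v a)%E.
Proof.
move=> ra uv; apply: le_esum => b /eqP ba; apply: lee_wpmul2l => //.
by rewrite lee_fin divr_ge0 ?(intensity_ge0 XT_chain)// subr_ge0 ltW.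
Qed.

(** One step of the recursion that defines [payoff], in terms of an event C that
    coincides with stopping on A only. *)
Lemma payoff_split i psi H k n (A C : set Omega) : (forall a, 0 <= psi a) ->
  adapted_rule H -> measurable A -> measurable C ->
  (forall w, A w -> C w <-> rule_stops H w k) ->
  (\int[P i]_(w in A) (payoff psi H k n.+1 w)%:E =
   \int[P i]_(w in A `&` C)
      (expR (alpha * fine ((T k w)%:E + H k w)%E) * G (Z k w))%:E +
   \int[P i]_(w in A `&` ~` C) (payoff psi H k.+1 n w)%:E)%E.
Proof.
move=> psi0 aH mA mC AC; rewrite -{1}(setIT A) -(setUv C) setIUr.
rewrite ge0_integral_setU//; last 5 first.
- exact: measurableI.
- by apply: measurableI => //; exact: measurableC.
- by apply: measurable_funTS; exact: measurable_payoff.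
- by move=> w _; rewrite lee_fin payoff_ge0.
- by apply/disj_setPLR => w [_ Cw] [].
congr (_ + _)%E; apply: eq_integral => w /[!inE] -[Aw Cw] /=.
  by rewrite ifT//; apply/AC.
by rewrite ifF//; apply/negP => /(AC w Aw).
Qed.

(** Backward induction from the truncation; [bellman_integral_le] is the step
    over one jump. *)
Lemma payoff_ge_value_iter i H n k (A : set Omega) :
  adapted_rule H -> measurable (A : set (history k)) ->
  (\int[P i]_(w in A) ((expR (alpha * T k w))%:E * value_iter n (Z k w)) <=
   \int[P i]_(w in A) (payoff G H k n w)%:E)%E.
Proof.
move=> aH; elim: n k A => [|n IHn] k A mA.
  by under [leRHS]eq_integral do rewrite /= EFinM.
have mS := stops_history (aH k).1.
rewrite (@payoff_split _ _ _ _ _ _ (stops (H k) k)) //; last 3 first.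
- by move=> a; exact/ltW.
- exact: history_measurable _ _ mA.
- exact: history_measurable _ _ mS.
have B := bellman_integral_le i mA (aH k).1 (aH k).2 (value_iter_gt0 n).
apply: le_trans B _.
apply: leeD => //; apply: IHn.
exact: (measurableI _ _ (history_le (leqnSn k) mA) (measurableC mS)).
Qed.

(** For delays 0 and infinity, decided by f, a bound u that stopping respects
    where f holds and waiting respects elsewhere is an upper bound of the
    cost.  The bound may depend on the number of jumps, for finite horizons,
    and the delays are prescribed on A only, for rules that remember an earlier
    state. *)
Lemma payoff_le i H (f : nat -> S -> bool) (u : nat -> S -> \bar R) n k (A : set Omega) :
  adapted_rule H -> measurable (A : set (history k)) ->
  (forall m w, (k <= m)%N -> A w -> H m w = if f m (Z m w) then 0 else +oo)%E ->
  (forall m a, 0 <= u m a)%E ->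
  (forall m a, (k <= m)%N -> f m a -> ((G a)%:E <= u m a)%E) ->
  (forall m a, (k <= m)%N -> ~~ f m a ->
    alpha < rate q a /\ (continue_cost (u m.+1) a <= u m a)%E) ->
  (\int[P i]_(w in A) (payoff (fun=> 0) H k n w)%:E <=
   \int[P i]_(w in A) ((expR (alpha * T k w))%:E * u k (Z k w)))%E.
Proof.
move=> aH + + u0; elim: n k A => [|n IHn] k A mA HA fu nfu.
  under eq_integral do rewrite /= mulr0.
  rewrite integral0; apply: integral_ge0 => w _.
  by rewrite mule_ge0// lee_fin expR_ge0.
(* C is the event of stopping at the k-th jump, as an event of the history. *)
pose C := [set w | f k (Z k w)].
have mC : measurable (C : set (history k)).
  rewrite (_ : C = (f k \o Z k) @^-1` [set true])// -[X in measurable X]setTI.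
  by apply: (history_state_fun (f k) (leqnn k)).
have mACk : measurable (A `&` ~` C : set (history k)).
  exact: (measurableI _ _ mA (measurableC mC)).
have mA' := history_measurable mA.
have mC' := history_measurable mC.
rewrite (@payoff_split _ _ _ _ _ _ C)//; last first.
  move=> w Aw; rewrite /C/= /rule_stops (HA k)//.
  case: (f k (Z k w)); first by rewrite adde0 lte_fin (jump_time_lt XT_chain).
  by rewrite addey// ltNge leey.
have mexp := measurable_discounted k (u k).
have e0 w : (0 <= (expR (alpha * T k w))%:E * u k (Z k w))%E.
  by rewrite mule_ge0// lee_fin expR_ge0.
rewrite -{3}(setIT A) -(setUv C) setIUr ge0_integral_setU//; last 4 first.
- exact: measurableI.
- exact: history_measurable _ _ mACk.
- exact: measurable_funTS.
- by apply/disj_setPLR => w [_ Cw] [].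
apply: leeD.
  apply: ge0_le_integral => //.
  - exact: measurableI.
  - by move=> w _; rewrite lee_fin mulr_ge0 ?expR_ge0// ltW.
  - by apply: measurable_funTS; exact: (measurable_stop_cost (aH k).1).
  - exact: measurable_funTS.
  move=> w [Aw Cw]; rewrite (HA k)// (_ : f k (Z k w))// adde0 /= EFinM.
  by apply: lee_wpmul2l; [rewrite lee_fin expR_ge0|exact: fu].
have mACk1 : measurable (A `&` ~` C : set (history k.+1)).
  exact: history_le (leqnSn k) mACk.
apply: (le_trans (IHn _ _ mACk1 _ _ _)).
- by move=> m w km [Aw _]; apply: HA => //; exact: ltnW.
- by move=> m a /ltnW; exact: fu.
- by move=> m a /ltnW; exact: nfu.
have rC w : (A `&` ~` C) w -> alpha < rate q (Z k w).
  by move=> [_ /= /negP/nfu]; case.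
rewrite (continue_integral i mACk)//.
have mACk' := history_measurable mACk.
apply: ge0_le_integral => //.
- move=> w /rC rw; rewrite mule_ge0 ?lee_fin ?expR_ge0//.
  exact: continue_cost_ge0.
- by apply: measurable_funTS; exact: measurable_discounted.
- exact: measurable_funTS.
move=> w [Aw /= /negP nf]; apply: lee_wpmul2l; first by rewrite lee_fin expR_ge0.
by case: (nfu k _ (leqnn k) nf).
Qed.

Lemma start_state i : P i [set w | Z 0 w = i] = 1%E.
Proof.
rewrite -(chain_start XT_chain i); congr (P i _); apply/seteqP.
by split => w; rewrite /= /jump_state (jump_time0 XT_chain).
Qed.

Lemma integral_start i (f : Omega -> \bar R) : measurable_fun setT f ->
  (forall w, 0 <= f w)%E ->
  (\int[P i]_w f w = \int[P i]_(w in [set w | Z 0 w = i]) f w)%E.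
Proof.
move=> mf f0; have mE := jump_state_measurable XT_chain 0 i.
rewrite [RHS]integral_mkcond; apply: ge0_ae_eq_integral => //.
- by apply: (measurable_restrictT _ mE).1; exact: measurable_funTS.
- by move=> w _; exact: erestrict_ge0.
exists (~` [set w | Z 0 w = i]); split; first exact: measurableC.
  by apply: (eq_trans (probability_setC (P i) mE)); rewrite start_state subee.
by move=> w /= ne Zw; apply: ne => _; rewrite patchE mem_set.
Qed.

Lemma integral_start_cst i (u : S -> \bar R) : (forall a, 0 <= u a)%E ->
  (\int[P i]_w ((expR (alpha * T 0 w))%:E * u (Z 0 w)) = u i)%E.
Proof.
move=> u0; rewrite integral_start; last 2 first.
- exact: measurable_discounted.
- by move=> w; rewrite mule_ge0// lee_fin expR_ge0.
transitivity (\int[P i]_(w in [set w | Z 0 w = i]) (cst (u i) w))%E.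
  apply: eq_integral => w /[!inE] /= ->.
  by rewrite (jump_time0 XT_chain) mulr0 expR0 mul1e.
by rewrite integral_cst//=; [rewrite start_state mule1|exact: (jump_state_measurable XT_chain)].
Qed.

(** * Rules that realise the upper bound *)

(** By the convexity behind [bellman_le_one_jump], rules that at each jump either
    stop at once or wait for the next one are enough for the upper bounds. *)
Definition jump_rule (f : nat -> Omega -> bool) (m : nat) (w : Omega) : \bar R :=
  if f m w then 0%E else +oo%E.

Lemma jump_rule_adapted f :
  (forall m, measurable_fun setT (f m : history m -> bool)) -> adapted_rule (jump_rule f).
Proof.
move=> mf m; split; last by move=> w; rewrite /jump_rule; case: ifP.
by apply: measurable_fun_ifT.
Qed.

Lemma jump_rule_stops (f : nat -> Omega -> bool) w k : f k w -> rule_stops (jump_rule f) w k.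
Proof.
by move=> fk; rewrite /rule_stops /jump_rule fk adde0 lte_fin (jump_time_lt XT_chain).
Qed.

Lemma rule_finite_as H i : adapted_rule H -> (forall w, exists k, rule_stops H w k) ->
  P i [set w | (rule_time H w < +oo)%E] = 1%E.
Proof.
move=> aH fin; rewrite -(@probability_setT _ _ _ (P i)); congr (P i _).
by apply/seteqP; split => // w _; apply/(rule_time_finite w aH).
Qed.

(** Whether to stop in state a with n further jumps to go; ties are resolved in
    favour of stopping. *)
Definition opt_stop n a : bool :=
  [|| n == 0%N, rate q a <= alpha | ((G a)%:E <= continue_cost (value_iter n.-1) a)%E].

Lemma opt_stopT n a : opt_stop n a -> ((G a)%:E <= value_iter n a)%E.
Proof.
case: n => [|n] //=; rewrite /opt_stop /= /bellman.
by case: ifPn => //= _; rewrite le_min lexx.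
Qed.

Lemma opt_stopF n a : ~~ opt_stop n a ->
  alpha < rate q a /\ (continue_cost (value_iter n.-1) a <= value_iter n a)%E.
Proof.
rewrite /opt_stop !negb_or -!ltNge; case: n => //= n /andP[ra Gc]; split => //.
by rewrite /bellman (lt_geF ra) le_min lexx (ltW Gc).
Qed.

Definition horizon_rule (N : nat) := jump_rule (fun m w => opt_stop (N - m)%N (Z m w)).

Lemma horizon_rule_adapted N : adapted_rule (horizon_rule N).
Proof.
apply: jump_rule_adapted => m.
exact: (history_state_fun (opt_stop (N - m)%N) (leqnn m)).
Qed.

Lemma horizon_rule_stops N w : rule_stops (horizon_rule N) w N.
Proof. by apply: jump_rule_stops; rewrite subnn. Qed.

(** The start k and the event A are arbitrary because [delayed_rule] runs an
    N b-jump rule only after the first jump, and only if this has led to b. *)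
Lemma horizon_payoff_le i H N k n (A : set Omega) : adapted_rule H ->
  measurable (A : set (history k)) ->
  (forall m w, (k <= m)%N -> A w ->
     H m w = jump_rule (fun m w => opt_stop (N - (m - k))%N (Z m w)) m w) ->
  (\int[P i]_(w in A) (payoff (fun=> 0) H k n w)%:E <=
   \int[P i]_(w in A) ((expR (alpha * T k w))%:E * value_iter N (Z k w)))%E.
Proof.
move=> aH mA HA.
have := @payoff_le i H
  (fun m => opt_stop (N - (m - k))%N) (fun m => value_iter (N - (m - k))%N) n k A aH mA HA.
rewrite subnn subn0; apply.
- by move=> m a; exact/ltW/(value_iter_gt0).
- by move=> m a _; exact: opt_stopT.
- by move=> m a km /opt_stopF; rewrite subSn// subnS.
Qed.

Lemma horizon_cost_le i N :
  (\int[P i]_w (stop_cost (rule_time (horizon_rule N) w) w)%:E <= value_iter N i)%E.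
Proof.
have aH := horizon_rule_adapted N.
apply: (integral_stop_cost_le aH).
  by apply: rule_finite_as => // w; exists N; exact: horizon_rule_stops.
move=> n; rewrite -[leRHS](integral_start_cst); last first.
  by move=> a; exact/ltW/(value_iter_gt0).
apply: horizon_payoff_le => // m w _ _.
  by rewrite /horizon_rule /jump_rule subn0.
Qed.

(** The competitor for which the lower bound yields the hard half of the fixed
    point equation.  It remembers the state Z 1, which determines its horizon. *)
Definition delayed_rule (N : S -> nat) := jump_rule (fun m w =>
  if m is m'.+1 then opt_stop (N (Z 1 w) - m')%N (Z m w) else false).

Lemma delayed_rule_adapted N : adapted_rule (delayed_rule N).
Proof.
apply: jump_rule_adapted => -[|m]; first exact: measurable_cst.
apply: (measurable_fun_fibers (S := (S * S)%type) (Om := history m.+1)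
  (Z := fun w => (Z 1 w, Z m.+1 w)) (fun ab => opt_stop (N ab.1 - m)%N ab.2)) => -[a b].
rewrite (_ : [set _ | _] = [set w | Z 1 w = a] `&` [set w | Z m.+1 w = b]).
  by apply: measurableI; exact: history_state.
by apply/seteqP; split => w /= [-> ->].
Qed.

Lemma delayed_rule_stops N w : rule_stops (delayed_rule N) w (N (Z 1 w)).+1.
Proof. by apply: jump_rule_stops; rewrite subnn. Qed.

(** Split along the state after the first jump: the rule costs at most
    [value_iter (N b) b] from b on, and the first jump is a step of
    [continue_integral]. *)
Lemma delayed_cost_le i (N : S -> nat) : alpha < rate q i ->
  (\int[P i]_w (stop_cost (rule_time (delayed_rule N) w) w)%:E <=
   continue_cost (fun b => value_iter (N b) b) i)%E.
Proof.
move=> ri; set u := fun b => value_iter (N b) b.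
have u0 b : (0 <= u b)%E by exact/ltW/(value_iter_gt0).
have aH := delayed_rule_adapted N.
have mZ1 := jump_state_measurable XT_chain 1.
have c0 : (0 <= continue_cost u i)%E by exact: continue_cost_ge0.
apply: (integral_stop_cost_le aH).
  by apply: rule_finite_as => // w; exists (N (Z 1 w)).+1; exact: delayed_rule_stops.
have pay0 k n w : (0 <= (payoff (fun=> 0) (delayed_rule N) k n w)%:E)%E.
  by rewrite lee_fin payoff_ge0.
have mp k n := measurable_payoff (fun=> 0) k n aH.
case=> [|n].
  by under eq_integral do rewrite /= mulr0; rewrite integral0.
have -> : (\int[P i]_w (payoff (fun=> 0) (delayed_rule N) 0 n.+1 w)%:E =
    \int[P i]_w (payoff (fun=> 0) (delayed_rule N) 1 n w)%:E)%E.
  exact: eq_integral.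
have mu1 := measurable_discounted 1 u.
apply: (@le_trans _ _ (\int[P i]_w ((expR (alpha * T 1 w))%:E * u (Z 1 w)))%E).
  rewrite (ge0_integral_fibers _ mZ1 measurableT)//.
  rewrite [leRHS](ge0_integral_fibers _ mZ1 measurableT)//; last first.
    by move=> w _; rewrite mule_ge0// lee_fin expR_ge0.
  apply: le_esum => b _; rewrite setTI.
  have -> : (\int[P i]_(w in [set w | Z 1 w = b]) ((expR (alpha * T 1 w))%:E * u (Z 1 w)) =
     \int[P i]_(w in [set w | Z 1 w = b]) ((expR (alpha * T 1 w))%:E * value_iter (N b) (Z 1 w)))%E.
    by apply: eq_integral => w /[!inE] /= ->.
  apply: horizon_payoff_le => //; first exact: history_state.
  by case=> // m w _ /= Zb; rewrite /delayed_rule /jump_rule Zb subn1.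
rewrite integral_start//; last by move=> w; rewrite mule_ge0// lee_fin expR_ge0.
have mE0 : measurable ([set w | Z 0 w = i] : set (history 0)) by exact: history_state.
rewrite (continue_integral i mE0)//; last by move=> w /= ->.
have mE := jump_state_measurable XT_chain 0 i.
rewrite (_ : integral _ _ _ = \int[P i]_(w in [set w | Z 0 w = i]) (cst (continue_cost u i) w))%E.
  by rewrite integral_cst//= start_state mule1.
apply: eq_integral => w /[!inE] /= ->.
by rewrite (jump_time0 XT_chain) mulr0 expR0 mul1e.
Qed.

(** One inequality holds because [bellman] is monotone.  For the other, the
    lower bound is applied to [delayed_rule N], where N b is so large that
    [value_iter (N b) b] is close to [value_inf b]; the infimum over n cannot be
    taken inside [continue_cost], whose value may be infinite for each n. *)
Lemma value_inf_fixpoint i :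
  (forall H, adapted_rule H -> P i [set w | (rule_time H w < +oo)%E] = 1%E ->
    (value_inf i <= \int[P i]_w (stop_cost (rule_time H w) w)%:E)%E) ->
  alpha < rate q i -> value_inf i = mine (G i)%:E (continue_cost value_inf i).
Proof.
move=> lower ri; apply/eqP; rewrite eq_le; apply/andP; split; last first.
  apply: le_ereal_inf_tmp => _ [[|n] _ <-] /=; first by rewrite ge_min lexx.
  rewrite /bellman (lt_geF ri) le_min !ge_min lexx/= (continue_cost_le) ?orbT//.
  by move=> b; exact: value_inf_le.
rewrite le_min value_inf_le_stop/=; apply/lee_addgt0Pr => e e0.
have r0 := rate_gt0 XT_chain i; have ra0 : 0 < rate q i - alpha by rewrite subr_gt0.
(* The error del at each state adds up to e, by [continue_mass]. *)
pose del := e * (rate q i - alpha) / rate q i.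
have del0 : 0 < del by rewrite divr_gt0// mulr_gt0.
have /choice[N NE] b : exists n, (value_iter n b <= value_inf b + del%:E)%E.
  have [_ [n _ <-] /ltW nle] := lb_ereal_inf_adherent del0 (value_inf_fin b).
  by exists n.
apply: (@le_trans _ _ (continue_cost (fun b => value_iter (N b) b) i)).
  apply: le_trans (delayed_cost_le N ri); apply: lower.
    exact: delayed_rule_adapted.
  apply: rule_finite_as; first exact: delayed_rule_adapted.
  by move=> w; exists (N (Z 1 w)).+1; exact: delayed_rule_stops.
apply: (le_trans (continue_cost_le ri NE)).
have p0 b : [set~ i] b -> (0 <= (q i b / (rate q i - alpha))%:E :> \bar R)%E.
  by move=> /eqP bi; rewrite lee_fin divr_ge0 ?(intensity_ge0 XT_chain)// ltW.
have v0 b := value_inf_ge0 b.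
rewrite /continue_cost.
rewrite (@eq_esum _ _ _ _ (fun b => (q i b / (rate q i - alpha))%:E * value_inf b +
    del%:E * (q i b / (rate q i - alpha))%:E)%E); last first.
  by move=> b bi; rewrite ge0_muleDr ?v0 ?lee_fin ?(ltW del0)// [X in (_ + X)%E]muleC.
rewrite esumD; last 2 first.
- by move=> b bi; rewrite mule_ge0 ?p0.
- by move=> b bi; rewrite mule_ge0 ?p0// lee_fin (ltW del0).
rewrite ge0_esumZl ?lee_fin ?(ltW del0)// (continue_mass ri) leeD2l// -EFinM lee_fin.
by rewrite /del mulrA divfK ?gt_eqF// mulfK ?gt_eqF.
Qed.

(** * Stopping rules are stopping times *)

(** The sigma-algebra of the measurable type [past t] is [natural_filtration]
    at t. *)
Definition past_generators t : set (set Omega) :=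
  [set A | exists s i, 0 <= s <= t /\ A = [set w | X s w = i]].

Definition past t := g_sigma_algebraType (past_generators t).

Lemma past_state s t i : 0 <= s <= t -> measurable ([set w | X s w = i] : set (past t)).
Proof. by move=> st; apply: sub_sigma_algebra; exists s, i. Qed.

Lemma past_le s t (A : set Omega) : s <= t ->
  measurable (A : set (past s)) -> measurable (A : set (past t)).
Proof.
move=> st; apply: sub_sigma_algebra2 => B [r [i [/andP[r0 rs] ->]]].
by exists r, i; rewrite r0 (le_trans rs st).
Qed.

(** Countably many times in [0, t] that include t: they meet each of the
    intervals between jumps that begin at t or earlier. *)
Definition sample (p : rat) (t : R) : R := Num.min (Num.max (ratr p) 0) t.

Lemma sample_itv p t : 0 <= t -> 0 <= sample p t <= t.
Proof. by move=> t0; rewrite le_min le_max lexx orbT t0 ge_min lexx orbT. Qed.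

Lemma sample_between k t w : T k w <= t -> exists p, T k w <= sample p t < T k.+1 w.
Proof.
move=> Tt; have [p] := rat_in_itvoo (jump_time_lt XT_chain k w).
rewrite in_itv/= => /andP[pl pr]; exists p.
have p0 : 0 <= ratr p :> R by exact: le_trans (time_ge0 k w) (ltW pl).
by rewrite /sample (max_idPl p0) le_min (ltW pl) Tt/= gt_min pr.
Qed.

(** The jump k + 1 has occurred by t if and only if two of the sample times after
    the k-th jump see different states. *)
Lemma past_time_le k t : 0 <= t -> measurable ([set w | T k w <= t] : set (past t)).
Proof.
elim: k t => [|k IHk] t t0.
  rewrite (_ : [set _ | _] = setT)//; apply/seteqP; split => // w _ /=.
  by rewrite (jump_time0 XT_chain).
have mTk p : measurable ([set w | T k w <= sample p t] : set (past t)).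
  have /andP[s0 st] := sample_itv p t0.
  by apply: past_le st _; exact: IHk.
rewrite (_ : [set _ | _] = \bigcup_p (\bigcup_p' (\bigcup_i
    ([set w | T k w <= sample p t] `&` [set w | T k w <= sample p' t] `&`
     ([set w | X (sample p t) w = i] `&` ~` [set w | X (sample p' t) w = i]))))).
  apply: bigcupT_measurable_rat => p; apply: bigcupT_measurable_rat => p'.
  apply: countable_bigcupT_measurable => // i.
  apply: measurableI; first exact: (measurableI _ _ (mTk p) (mTk p')).
  apply: measurableI; first exact: past_state (sample_itv p t0).
  exact: (measurableC (past_state i (sample_itv p' t0))).
apply/seteqP; split => w /=.
  move=> Tt; have [p' p'T] := sample_between Tt.
  have [p pT] := sample_between (le_trans (ltW (jump_time_lt XT_chain k w)) Tt).
  exists p => //; exists p' => //; exists (Z k w) => //; split; split.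
  - by case/andP: pT.
  - case/andP: p'T => + _; apply: le_trans; exact/ltW/(jump_time_lt XT_chain).
  - by rewrite /= (chain_path XT_chain pT).
  - by rewrite /= (chain_path XT_chain p'T); exact: (jump_neq XT_chain).
move=> [p _ [p' _ [i _ [[/= Tp Tp'] [Xp Xp']]]]]; rewrite leNgt; apply/negP => tT.
have itv p0 : T k w <= sample p0 t -> X (sample p0 t) w = Z k w.
  move=> Tp0; apply: (chain_path XT_chain); rewrite Tp0/=.
  by apply: le_lt_trans tT; case/andP: (sample_itv p0 t0).
by apply: Xp' => /=; rewrite (itv _ Tp') -(itv _ Tp).
Qed.

Lemma past_jump_state k t i : 0 <= t ->
  measurable ([set w | Z k w = i] `&` [set w | T k w <= t] : set (past t)).
Proof.
move=> t0; have mT m p : measurable ([set w | T m w <= sample p t] : set (past t)).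
  have /andP[s0 st] := sample_itv p t0.
  by apply: past_le st _; exact: past_time_le.
rewrite (_ : _ `&` _ = \bigcup_p ([set w | T k w <= sample p t] `&`
   ~` [set w | T k.+1 w <= sample p t] `&` [set w | X (sample p t) w = i])).
  apply: bigcupT_measurable_rat => p.
  apply: measurableI; last exact: past_state (sample_itv p t0).
  exact: (measurableI _ _ (mT k p) (measurableC (mT k.+1 p))).
apply/seteqP; split => w /=.
  move=> [Zi Tt]; have [p pT] := sample_between Tt; exists p => //.
  rewrite /= (chain_path XT_chain pT); case/andP: pT => pl pr; split => //.
  by split => //; apply/negP; rewrite -ltNge.
move=> [p _ [[/= pl /negP]]]; rewrite -ltNge => pr Xi.
rewrite -(chain_path XT_chain (t := sample p t)) ?pl//; split => //.
by apply: le_trans pl _; case/andP: (sample_itv p t0).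
Qed.

Lemma past_jump_time m k t (B : set R) : 0 <= t -> (m <= k)%N -> measurable B ->
  measurable (T m @^-1` B `&` [set w | T k w <= t] : set (past t)).
Proof.
move=> t0 mk mB; have mD := past_time_le k t0.
suff mT : measurable_fun ([set w | T k w <= t] : set (past t)) (T m : past t -> R).
  by rewrite setIC; exact: mT.
(* The events that T m exceeds x generate; T m <= x is replaced by
   T m <= min x t, which is the same where T k <= t. *)
apply: (measurability _ (RGenOInfty.measurableE R)) => _ [_ [x ->] <-].
have [x0|x0] := ltP x 0.
  rewrite (_ : _ `&` _ = [set w | T k w <= t])//; apply/seteqP; split => w /= => [[]//|Tt].
  by split => //=; rewrite in_itv/= andbT (lt_le_trans x0)// (time_ge0).
have mx : measurable ([set w | T m w <= Num.min x t] : set (past t)).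
  apply: (@past_le (Num.min x t)); first by rewrite ge_min lexx orbT.
  by apply: past_time_le; rewrite le_min x0.
rewrite (_ : _ `&` _ = [set w | T k w <= t] `&` ~` [set w | T m w <= Num.min x t]).
  exact: (measurableI _ _ mD (measurableC mx)).
apply/seteqP; split => w /= [Tt]; rewrite in_itv/= andbT.
  by move=> xT; split => //; rewrite le_min => /andP[]; rewrite leNgt xT.
move=> /negP; rewrite le_min (le_trans (time_le w mk) Tt) andbT -ltNge.
by split.
Qed.

(** The events A with this property form a sigma-algebra. *)
Lemma past_history k t (A : set Omega) : 0 <= t ->
  measurable (A : set (history k)) ->
  measurable (A `&` [set w | T k w <= t] : set (past t)).
Proof.
move=> t0; have mD := past_time_le k t0.
suff sub : <<s history_generators k >> `<=` [set A : set Omega |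
  measurable (A `&` [set w | T k w <= t] : set (past t))] by exact: sub.
apply: smallest_sub.
  split => /=.
  - by rewrite set0I; exact: measurable0.
  - move=> B mB; rewrite setTD (_ : _ `&` _ = [set w | T k w <= t] `&` ~` (B `&` [set w | T k w <= t])).
      exact: (measurableI _ _ mD (measurableC mB)).
    apply/seteqP; split => w /=; first by move=> [nA Tt]; split => // -[].
    by move=> [Tt nAT]; split => // Aw; apply: nAT.
  - by move=> F mF; rewrite setI_bigcupl; apply: bigcupT_measurable.
move=> _ [m mk [[i ->]|[B mB ->]]] /=; last exact: past_jump_time.
rewrite (_ : _ `&` _ = [set w | Z m w = i] `&` [set w | T m w <= t] `&` [set w | T k w <= t]).
  exact: (measurableI _ _ (past_jump_state m i t0) mD).
apply/seteqP; split => w /=; last by move=> [[]].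
by move=> [Zi Tt]; split => //; split => //; exact: le_trans (time_le w mk) Tt.
Qed.

Lemma history_unstopped H k : adapted_rule H ->
  measurable ([set w | forall m, (m < k)%N -> ~~ rule_stops H w m] : set (history k)).
Proof.
move=> aH; elim: k => [|k IHk].
  by rewrite (_ : [set _ | _] = setT)//; apply/seteqP.
rewrite (_ : [set _ | _] = [set w | forall m, (m < k)%N -> ~~ rule_stops H w m] `&`
  ~` stops (H k) k).
  exact: (measurableI _ _ (history_le (leqnSn k) IHk) (measurableC (stops_history (aH k).1))).
apply/seteqP; split => w /=.
  move=> ns; split; first by move=> m mk; apply: ns; exact: ltnW.
  exact/negP/ns.
by move=> [ns /negP nk] m; rewrite ltnS leq_eqVlt => /predU1P[->|]; last exact: ns.
Qed.

(** Whether the rule stops after the k-th jump depends on the next jump, which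
    may be later than t.  But if the delay runs out by t, then the rule fails to
    stop only if the next jump occurs by t. *)
Lemma rule_time_stopping H t : adapted_rule H -> 0 <= t ->
  natural_filtration X t [set w | (rule_time H w <= t%:E)%E].
Proof.
move=> aH t0; change (measurable ([set w | (rule_time H w <= t%:E)%E] : set (past t))).
pose U k := [set w | forall m, (m < k)%N -> ~~ rule_stops H w m].
pose E k := [set w | ((T k w)%:E + H k w <= t%:E)%E].
have mE k : measurable (E k : set (history k)).
  rewrite -[X in measurable X]setTI.
  apply: (@emeasurable_fun_infty_c _ (history k)) => //.
  apply: emeasurable_funD; last exact: (aH k).1.
  by apply/measurable_EFinP; exact: history_time.
rewrite (_ : [set _ | _] = \bigcup_k (U k `&` E k `&` [set w | T k w <= t] `&`
  ~` (~` stops (H k) k `&` [set w | T k.+1 w <= t]))).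
  apply: bigcupT_measurable => k; apply: (@measurableI _ (past t)).
    exact: (past_history t0 (measurableI _ _ (history_unstopped aH) (mE k))).
  apply: (@measurableC _ (past t)).
  exact: (past_history t0 (measurableC (stops_history (aH k).1))).
apply/seteqP; split => w /=.
  have [[k sk nsm]|ns] := rule_time_cases H w; last first.
    by rewrite rule_time_infty// leye_eq.
  rewrite (rule_time_stop sk nsm) => le_t; exists k => //; split => /=.
    split => //; have [h hE /andP[Th _]] := rule_stops_fin (aH k).2 sk.
    by apply: le_trans Th _; rewrite -lee_fin EFinD -hE.
  by case.
move=> [k _ [[[Uk Ek] Tk]] nST].
have sk : rule_stops H w k.
  apply/negPn/negP => nsk; apply: nST; split; first exact/negP.
  by rewrite /= -lee_fin; apply: le_trans Ek; rewrite leNgt.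
by rewrite (rule_time_stop sk Uk).
Qed.

End optimal_stopping.

(** * Exponential utility *)

Section exponential_utility.
Context (R : realType) (S : countType) (d : measure_display)
  (Omega : measurableType d) (P : S -> probability Omega R) (q : S -> S -> R)
  (X : R -> Omega -> S) (T : nat -> Omega -> R)
  (XT_chain : markov_chain P q X T).
Local Notation Z := (jump_state X T).
Context (g : S -> R) (c gamma : R).
Let alpha := c * gamma.
Let G (a : S) := expR (- gamma * g a).
Local Notation U := (exp_utility gamma).
Local Notation history := (history X T).
Local Notation rule_time := (rule_time T).
Local Notation rule_stops := (rule_stops T).
Local Notation adapted_rule := (adapted_rule X T).
Local Notation continue_cost := (continue_cost q alpha).
Local Notation payoff := (payoff X T alpha G).
Local Notation stop_cost := (stop_cost X alpha G).
Local Notation value_iter := (value_iter q alpha G).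
Local Notation value_inf := (value_inf q alpha G).

Let G0 a : 0 < G a. Proof. exact: expR_gt0. Qed.

Definition rule_cost (H : nat -> Omega -> \bar R) (i : S) : \bar R :=
  (\int[P i]_w (stop_cost (rule_time H w) w)%:E)%E.

Lemma gain_stop_cost t (tau : Omega -> \bar R) w :
  gain U g c X t tau w = - (expR (alpha * t) * stop_cost (tau w) w).
Proof.
rewrite /gain /exp_utility /stop_cost /G /alpha -!expRD; congr (- expR _); ring.
Qed.

Lemma stop_cost_ge0 t w : 0 <= stop_cost t w.
Proof. by rewrite mulr_ge0 ?expR_ge0. Qed.

Lemma expectation_gain i t (tau : Omega -> \bar R) :
  measurable_fun setT (fun w => (stop_cost (tau w) w)%:E) ->
  ('E_(P i)[gain U g c X t tau] =
   - ((expR (alpha * t))%:E * \int[P i]_w (stop_cost (tau w) w)%:E))%E.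
Proof.
move=> mtau; rewrite unlock.
under eq_integral do rewrite gain_stop_cost EFinN EFinM.
rewrite integral_ge0N; last first.
  by move=> w _; rewrite -EFinM lee_fin mulr_ge0 ?expR_ge0 ?stop_cost_ge0.
by rewrite ge0_integralZl// => w _; rewrite lee_fin stop_cost_ge0.
Qed.

Lemma expected_gain_rule (H : nat -> Omega -> \bar R) h t i : adapted_rule H ->
  markovian_time X T h t =1 rule_time H ->
  expected_gain P X T U g c h t i = (- ((expR (alpha * t))%:E * rule_cost H i))%E.
Proof.
move=> aH /funext hH; rewrite /expected_gain hH expectation_gain//.
exact: (measurable_stop_cost_rule XT_chain).
Qed.

Lemma rule_time_ext H H' w : (forall m, H m w = H' m w) -> rule_time H w = rule_time H' w.
Proof.
move=> HH'; have ss k : rule_stops H w k = rule_stops H' w k.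
  by rewrite /rule_stops HH'.
have [[k sk ns]|ns] := rule_time_cases T H w.
  rewrite (rule_time_stop sk ns) HH'; apply/esym/rule_time_stop; first by rewrite -ss.
  by move=> m mk; rewrite -ss ns.
by rewrite !rule_time_infty// => k; rewrite -ss.
Qed.

Lemma probability_eq1_sub i (A B : set Omega) : measurable A -> measurable B ->
  A `<=` B -> P i A = 1%E -> P i B = 1%E.
Proof.
move=> mA mB AB A1; apply/eqP; rewrite eq_le probability_le1//= -A1.
by apply: le_measure; rewrite ?inE.
Qed.

(** The truncated rules cost at least [value_inf], and (A2) compares the rule
    with its truncations. *)
Lemma value_inf_le_cost (A2 : assumption_A2 P X T U g c) H i : adapted_rule H ->
  P i [set w | (rule_time H w < +oo)%E] = 1%E ->
  (value_inf i <= rule_cost H i)%E.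
Proof.
(* (A2) requires times that are finite from every starting state: off the
   P i-almost sure event Z_0 = i, the rule is replaced by stopping at once. *)
move=> aH fin; pose H' m w := if Z 0 w == i then H m w else 0%E.
have mb m : measurable_fun setT ((fun w => Z 0 w == i) : history m -> bool).
  exact: (history_state_fun (fun a => a == i) (leq0n m)).
have aH' : adapted_rule H'.
  move=> m; split.
    by apply: measurable_fun_ifT => //; exact: (aH m).1.
  by move=> w; rewrite /H'; case: ifP => // _; exact: (aH m).2.
have eqi w : Z 0 w = i -> rule_time H' w = rule_time H w.
  by move=> Zi; apply: rule_time_ext => m; rewrite /H' Zi eqxx.
have nei w : Z 0 w != i -> (rule_time H' w < +oo)%E.
  move=> Zi; apply/(rule_time_finite w aH'); exists 0%N.
  rewrite /rule_stops /H' (negbTE Zi) adde0 lte_fin; exact: (jump_time_lt XT_chain).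
have mF := measurable_rule_finite XT_chain aH.
have mF' := measurable_rule_finite XT_chain aH'.
have stop' : stopping_times P X (rule_time H').
  split => [w|t t0|j].
  - exact: rule_time_ge0 XT_chain _ _ aH'.
  - exact: (rule_time_stopping XT_chain).
  have [->|ji] := eqVneq j i.
    apply: probability_eq1_sub fin => // w /= tw.
    by have [Zi|/nei//] := eqVneq (Z 0 w) i; rewrite eqi.
  apply: probability_eq1_sub (start_state XT_chain j) => //.
    exact: (jump_state_measurable XT_chain).
  by move=> w /= Zj; apply: nei; rewrite Zj.
have mcost H0 (a0 : adapted_rule H0) := measurable_stop_cost_rule XT_chain alpha G a0.
have cE : rule_cost H i = rule_cost H' i.
  have cost0 H0 w : (0 <= (stop_cost (rule_time H0 w) w)%:E)%E.
    by rewrite lee_fin stop_cost_ge0.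
  rewrite /rule_cost (integral_start XT_chain i (mcost H aH)); last exact: cost0.
  rewrite [RHS](integral_start XT_chain i (mcost H' aH')); last exact: cost0.
  by apply: eq_integral => w /[!inE] /= Zi; rewrite eqi.
have := A2 i 0 _ (lexx 0) stop'.
rewrite expectation_gain; last exact: mcost.
rewrite mulr0 expR0 mul1e -/(rule_cost H' i) -cE => le_A2.
rewrite -leeN2; apply: (le_trans le_A2).
rewrite limn_einf_lim; apply: lime_le; first exact: is_cvg_einfs.
apply: nearW => n; apply: (@le_trans _ _ ('E_(P i)[gain U g c X 0
    (fun w => mine (rule_time H' w) (T n w)%:E)])%E).
  by apply: ereal_inf_lbound; exists n => /=.
have pE w : stop_cost (mine (rule_time H' w) (T n w)%:E) w = payoff G H' 0 n w.
  by rewrite -(payoff_truncated XT_chain _ _ (k := 0)).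
rewrite expectation_gain; last first.
  by under eq_fun do rewrite pE; exact: (measurable_payoff XT_chain).
rewrite mulr0 expR0 mul1e leeN2 (eq_integral _ _ (fun w _ => congr1 EFin (pE w))).
have := payoff_ge_value_iter XT_chain alpha G0 i n aH' (measurableT : measurable (setT : set (history 0))).
rewrite (integral_start_cst XT_chain alpha i); last first.
  by move=> a; exact/ltW/(value_iter_gt0 XT_chain).
by apply: le_trans; exact: value_inf_le.
Qed.

Definition markov_rule (h : nat -> R -> S -> \bar R) (t : R) (k : nat) (w : Omega) :=
  h k (t + T k w) (Z k w).

(** Only countably many states occur, so the sections of h suffice. *)
Lemma markov_rule_adapted h t : decision_rules h -> 0 <= t ->
  adapted_rule (markov_rule h t).
Proof.
move=> dh t0 k; split; last first.
  by move=> w; apply: (dh k (Z k w)).2; rewrite addr_ge0// (time_ge0 XT_chain).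
move=> _ B mB; rewrite setTI.
rewrite (_ : _ @^-1` B = \bigcup_a ([set w | Z k w = a] `&`
    (fun w => h k (t + T k w) a) @^-1` B)); last first.
  apply/seteqP; split => w /=; first by move=> Bw; exists (Z k w).
  by move=> [a _ [/= Za]]; rewrite -{1}Za.
apply: countable_bigcupT_measurable => // a.
have mZ : measurable ([set w | Z k w = a] : set (history k)) by exact: history_state.
apply: (measurableI _ _ mZ).
have mT : measurable_fun setT ((fun w => t + T k w) : history k -> R).
  by apply: measurable_funD => //; exact: history_time.
have mh : measurable_fun setT ((h k)^~ a \o (fun w => t + T k w) : history k -> \bar R).
  apply: measurable_comp (dh k a).1 mT; first exact: measurable_itv.
  by move=> _ [w _ <-]; rewrite /= in_itv/= andbT addr_ge0// (time_ge0 XT_chain).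
by have := mh measurableT B mB; rewrite setTI.
Qed.

Definition horizon_decision (N k : nat) (_ : R) (a : S) : \bar R :=
  if opt_stop q alpha G (N - k)%N a then 0%E else +oo%E.

Lemma horizon_decisionE N t : markovian_time X T (horizon_decision N) t =1
  rule_time (horizon_rule q X T alpha G N).
Proof. by []. Qed.

Lemma horizon_markovian N : markovian_times P X T (horizon_decision N).
Proof.
split.
  move=> k a; split; first exact: measurable_cst.
  by move=> t _; rewrite /horizon_decision; case: ifP.
move=> i t t0; apply: rule_finite_as.
  exact: (horizon_rule_adapted q X T alpha G N).
by move=> w; exists N; exact: (horizon_rule_stops XT_chain).
Qed.

Context (A2 : assumption_A2 P X T U g c).

(** Every admissible rule costs at least [value_inf], and the horizon rules,
    which do not depend on the elapsed time, come arbitrarily close to it; the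
    elapsed time only contributes the factor. *)
Lemma valueE t i : 0 <= t ->
  value P X T U g c t i = (- ((expR (alpha * t))%:E * value_inf i))%E.
Proof.
move=> t0; have e0 : (0 <= (expR (alpha * t))%:E :> \bar R)%E by rewrite lee_fin expR_ge0.
apply/eqP; rewrite eq_le; apply/andP; split.
  apply: ge_ereal_sup => _ [h [dh fin] <-].
  have ah := markov_rule_adapted dh t0.
  rewrite (expected_gain_rule i ah) // leeN2; apply: lee_wpmul2l => //.
  by apply: (value_inf_le_cost A2 ah); exact: fin.
have [v vE] : exists v, value_inf i = v%:E.
  by exists (fine (value_inf i)); rewrite fineK// (value_inf_fin XT_chain).
rewrite vE leeNl -lee_pdivrMl ?expR_gt0// -vE.
apply: le_ereal_inf_tmp => _ [N _ <-].
rewrite lee_pdivrMl ?expR_gt0// leeNl; apply: le_ereal_sup_tmp.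
exists (expected_gain P X T U g c (horizon_decision N) t i).
  by exists (horizon_decision N) => //; exact: horizon_markovian.
have aN := horizon_rule_adapted q X T alpha G N.
rewrite (expected_gain_rule i aN (horizon_decisionE N t)) leeN2.
by apply: lee_wpmul2l => //; exact: horizon_cost_le.
Qed.

Let W i := fine (value P X T U g c 0 i).

Lemma value0E i : (W i)%:E = (- value_inf i)%E.
Proof.
rewrite /W valueE// mulr0 expR0 mul1e fineK// fin_numN.
exact: (value_inf_fin XT_chain).
Qed.

Lemma value_timeE t i : 0 <= t ->
  value P X T U g c t i = (expR (alpha * t) * W i)%:E.
Proof. by move=> t0; rewrite valueE// EFinM value0E [RHS]muleN. Qed.

Lemma continuation_valueE i : alpha < rate q i ->
  continuation_value q c gamma W i = (- continue_cost value_inf i)%E.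
Proof.
move=> ri; have ra0 : 0 < rate q i - alpha by rewrite subr_gt0.
have p0 b : [set~ i] b -> (0 <= (q i b / (rate q i - alpha))%:E :> \bar R)%E.
  by move=> /eqP bi; rewrite lee_fin divr_ge0 ?(intensity_ge0 XT_chain)// ltW.
have fE b : ((q i b / (rate q i - c * gamma) * W b)%:E =
    - ((q i b / (rate q i - alpha))%:E * value_inf b))%E.
  by rewrite EFinM value0E [LHS]muleN.
have v0 b : (0 <= value_inf b)%E := value_inf_ge0 XT_chain alpha G0 b.
rewrite /continuation_value /signed_sum esum1 ?add0e; last first.
  move=> b bi; rewrite funeposE fE; apply/max_idPr.
  by rewrite leeNl oppe0 mule_ge0// p0.
congr (- _)%E; apply: eq_esum => b bi; rewrite funenegE fE oppeK.
by apply/max_idPl; rewrite mule_ge0// p0.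
Qed.

Lemma stop_valueE i : (stop_value gamma g i)%:E = (- (G i)%:E)%E.
Proof. by []. Qed.

(** Where waiting does not pay, [bellman] returns G whatever its argument. *)
Lemma value_inf_low_rate i : rate q i <= alpha -> value_inf i = (G i)%:E.
Proof.
move=> ri; apply/eqP; rewrite eq_le value_inf_le_stop/=.
by apply: le_ereal_inf_tmp => _ [[|n] _ <-] //=; rewrite /bellman ri.
Qed.

Lemma value_fixpoint i : alpha < rate q i ->
  value_inf i = mine (G i)%:E (continue_cost value_inf i).
Proof.
move=> ri; apply: (value_inf_fixpoint XT_chain G0) => // H aH fin.
exact: (value_inf_le_cost A2 aH fin).
Qed.

(** The fixed point equation says that [value_inf] itself is a bound u as in
    [payoff_le], whatever the number of jumps. *)
Lemma maximizer_cost_le f i : maximizer q c gamma g W f ->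
  P i [set w | (markovian_time X T (fun _ _ a => f a) 0 w < +oo)%E] = 1%E ->
  adapted_rule (markov_rule (fun _ _ a => f a) 0) ->
  (rule_cost (markov_rule (fun _ _ a => f a) 0) i <= value_inf i)%E.
Proof.
move=> fmax fin aH.
have v0 b : (0 <= value_inf b)%E := value_inf_ge0 XT_chain alpha G0 b.
have stop_le a : f a == 0%E -> ((G a)%:E <= value_inf a)%E.
  have [ri|ri] := leP (rate q a) alpha; first by rewrite value_inf_low_rate.
  move=> /eqP fa; have [_ /(_ ri)[[_]|[fy]]] := fmax a; last by move: fy; rewrite fa.
  rewrite continuation_valueE// stop_valueE -oppe_min => /oppe_inj mE.
  by rewrite value_fixpoint// mE.
have continue_le a : f a != 0%E -> alpha < rate q a /\
    f a = +oo%E /\ (continue_cost value_inf a <= value_inf a)%E.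
  move=> fa; have [ri|ri] := leP (rate q a) alpha.
    by move: fa; rewrite (fmax a).1 ?eqxx.
  split => //; have [_ /(_ ri)[[f0]|[-> ]]] := fmax a.
    by move: fa; rewrite f0 eqxx.
  rewrite continuation_valueE// stop_valueE -oppe_min => /oppe_inj mE; split => //.
  by rewrite [leRHS]value_fixpoint// mE.
apply: (integral_stop_cost_le XT_chain G0 aH) => // n.
rewrite -[leRHS](integral_start_cst XT_chain alpha)//.
apply: (@payoff_le _ _ _ _ _ _ _ _ XT_chain alpha G G0 i _ (fun=> fun a => f a == 0%E)
  (fun=> value_inf) n 0 setT aH) => //.
- move=> m w _ _; rewrite /markov_rule; case: eqP => [//|/eqP fa].
  by have [_ []] := continue_le _ fa.
- by move=> m a _; exact: stop_le.
- by move=> m a _ fa; have [? []] := continue_le _ fa.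
Qed.

End exponential_utility.

Theorem theorem5p4 (R : realType) (S : countType) (d : measure_display)
    (Omega : measurableType d) (P : S -> probability Omega R)
    (q : S -> S -> R) (X : R -> Omega -> S) (T : nat -> Omega -> R)
    (g : S -> R) (c gamma : R)
    (c_gt0 : 0 < c) (gamma_gt0 : 0 < gamma)
    (XT_chain : markov_chain P q X T)
    (A1 : assumption_A1 P X g c)
    (A2 : assumption_A2 P X T (exp_utility gamma) g c) :
  let V := value P X T (exp_utility gamma) g c in
  let W := fun i => fine (V 0 i) in
  let attains h t i :=
    expected_gain P X T (exp_utility gamma) g c h t i = V t i in
  [/\ (* W is well defined *)
      forall i, W i <= 0 /\
        forall t, 0 <= t -> V t i = (expR (c * gamma * t) * W i)%:E,
      (* the case q_i <= c gamma *)
      forall i, rate q i <= c * gamma ->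
        W i = stop_value gamma g i /\
        (let tau0 := fun _ _ _ => 0%E in
         markovian_times P X T tau0 /\
         forall t, 0 <= t -> attains tau0 t i),
      (* a) *)
      forall i, c * gamma < rate q i ->
        ((W i)%:E = maxe (stop_value gamma g i)%:E
                         (continuation_value q c gamma W i))%E
    & (* b) *)
      (exists f, maximizer q c gamma g W f) /\
      forall f, maximizer q c gamma g W f ->
        let h := fun _ _ i => f i in
        let tau := markovian_time X T h 0 in
        ((forall i, P i [set w | (tau w < +oo)%E] = 1%E) ->
           markovian_times P X T h) /\
        (forall i, P i [set w | (tau w < +oo)%E] = 1%E ->
           ('E_(P i)[fun w => (W (jump_state X T n w) *
                              \1_[set w' | ((T n w')%:E <= tau w')%E] w)%R]
             @[n --> \oo] --> 0)%E ->
           forall t, 0 <= t -> attains h t i)].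
Proof.
move=> V W attains; pose vinf := value_inf q (c * gamma) (fun a => expR (- gamma * g a)).
have WE i : (W i)%:E = (- vinf i)%E by exact: (value0E XT_chain A2).
have VE t i : 0 <= t -> V t i = (- ((expR (c * gamma * t))%:E * vinf i))%E.
  exact: (valueE XT_chain A2).
(* Being optimal means that the cost computed from time 0 is [value_inf]. *)
have attains_cost h t i H : 0 <= t -> adapted_rule X T H ->
    markovian_time X T h t =1 rule_time T H ->
    rule_cost P X T g c gamma H i = vinf i -> attains h t i.
  by move=> t0 aH hH HE; rewrite /attains (expected_gain_rule XT_chain _ _ _ _ aH hH) HE VE.
split.
- move=> i; split; last by move=> t t0; exact: (value_timeE XT_chain A2).
  rewrite -lee_fin WE leeNl oppe0; apply: (value_inf_ge0 XT_chain) => a.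
  exact: expR_gt0.
- move=> i ri; have vE := value_inf_low_rate g ri; split.
    by apply: EFin_inj; rewrite WE /vinf vE.
  (* Stopping at once is the optimal rule for horizon 0. *)
  move=> tau0; have E0 : tau0 = horizon_decision q g c gamma 0.
    by apply/funext => k; apply/funext => s; apply/funext => a.
  split; first by rewrite E0; exact: (horizon_markovian XT_chain).
  move=> t t0; rewrite E0.
  have aN := horizon_rule_adapted q X T (c * gamma) (fun a => expR (- gamma * g a)) 0.
  apply: (attains_cost _ _ _ _ t0 aN) => //.
  apply/eqP; rewrite eq_le; apply/andP; split.
    rewrite /vinf vE.
    exact: (horizon_cost_le XT_chain (c * gamma) (fun a => expR_gt0 (- gamma * g a)) i 0).
  apply: (value_inf_le_cost XT_chain A2 aN); apply: rule_finite_as => // w.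
  by exists 0%N; exact: (horizon_rule_stops XT_chain).
- move=> i ri; rewrite WE (continuation_valueE XT_chain A2)// stop_valueE -oppe_min.
  by rewrite /vinf (value_fixpoint XT_chain A2 ri).
split.
  pose f a : \bar R := if rate q a <= c * gamma then 0%E else
    if (continuation_value q c gamma W a <= (stop_value gamma g a)%:E)%E then 0%E else +oo%E.
  exists f => a /=; rewrite /f; split; first by move=> ->.
  move=> ra; rewrite (lt_geF ra); case: ifPn => [le_ca|].
    by left; split => //; apply/max_idPl.
  by rewrite -ltNge => /ltW le_ac; right; split => //; apply/max_idPr.
move=> f fmax h tau.
have dh : decision_rules h.
  move=> k a; split; first exact: measurable_cst.
  move=> t _; rewrite /h; have [ra|ra] := leP (rate q a) (c * gamma).
    by rewrite (fmax a).1.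
  by have [_ /(_ ra)[[->]|[->]]] := fmax a.
split; first by move=> fin; split => // i t t0; exact: fin.
move=> i fin _ t t0.
have ah := markov_rule_adapted XT_chain dh (lexx 0).
apply: (attains_cost _ _ _ _ t0 ah) => //.
apply/eqP; rewrite eq_le (maximizer_cost_le XT_chain A2 fmax fin ah)/=.
exact: (value_inf_le_cost XT_chain A2 ah fin).
Qed.
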